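(* Let $S$ be a compact Riemann surface of genus at least $2$ and let $G$ be a subgroup of $\mathrm{Aut}(S)$ acting on $S$ with signature $(0;m_1,\dots,m_r)$. Let $\Gamma$, its generators $x_1,\dots,x_r$, the isomorphism $f:\Delta/K\to S$, the epimorphism $\theta:\Gamma\to G$ with kernel $K$, and the points $P_1,\dots,P_r\in S$ be as described in the context. Then $\theta$ is determined by the fixed points of the action and their stabilizer groups, in the following sense: for each $j=1,\dots,r$, if $\tau_j$ is a generator of the stabilizer $G_{P_j}$, then $$\theta(x_j)=\tau_j^{\xi_j},$$ where the number $\xi_j$ with $1\le \xi_j<m_j$, $\gcd(\xi_j,m_j)=1$, is determined by $$\delta_{P_j}(\tau_j)=\omega_{m_j}^{\eta_j},\quad 1\le\eta_j<m_j,\ \gcd(\eta_j,m_j)=1,\qquad \eta_j\,\xi_j\equiv 1\pmod{m_j}.$$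
   Context: $\mathrm{Aut}(S)$ is the group of biholomorphic self-maps of $S$; $\omega_m=\exp(2\pi i/m)$; $G_P=\{\sigma\in G:\sigma(P)=P\}$, which is cyclic. For $P\in S$ and $\sigma\in \mathrm{Aut}(S)$ fixing $P$, $\delta_P(\sigma)\in\mathbb{C}$ is the linear coefficient $c_1$ in the expansion $\phi\circ\sigma\circ\phi^{-1}(z)=\sum_{m\ge1}c_m z^m$ for any chart $\phi$ centered at $P$; $\delta_P$ is an injective homomorphism from the stabilizer of $P$ in $\mathrm{Aut}(S)$ into the unit circle. $G$ acts on $S$ with signature $(\gamma;m_1,\dots,m_r)$ if $S/G$ has genus $\gamma$, the projection $S\to S/G$ has exactly $r$ branch points, and the points above them have multiplicities (stabilizer orders) $m_1,\dots,m_r\geq 2$. Setting: $\Delta$ is the unit disk, $\mathrm{Aut}(\Delta)$ its group of Möbius self-maps. $\Gamma\le \mathrm{Aut}(\Delta)$ is a Fuchsian group (discrete, finitely generated, without parabolic elements, with limit set the whole unit circle) of the same signature $(0;m_1,\dots,m_r)$ as the action, $K$ is a torsion-free normal subgroup of $\Gamma$, $f:\Delta/K\to S$ is an isomorphism of Riemann surfaces, and $\theta:\Gamma\to G$ is the epimorphism with kernel $K$ given by $\theta(x)=f\circ\widetilde x\circ f^{-1}$, where $\widetilde x$ is the automorphism of $\Delta/K$ induced by $x$ (i.e. $\pi_K\circ x=\widetilde x\circ\pi_K$ with $\pi_K:\Delta\to\Delta/K$ the projection). Such data exist for every such action. $\Gamma$ has the presentation $$\Gamma=\langle x_1,\dots,x_r:\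 x_1^{m_1}=\cdots=x_r^{m_r}=x_1\cdots x_r=1\rangle$$ associated with its canonical hyperbolic polygon, in which each $x_j$ is a positive minimal rotation, i.e. conjugate in $\mathrm{Aut}(\Delta)$ to $z\mapsto\exp(2\pi i/m_j)z$. For each $j$, $z_j\in\Delta$ is the fixed point of $x_j$ and $P_j=f(\pi_K(z_j))$. *)

(* Defs.v *)
(* MathComp-Analysis: the complex numbers are R[i] for R : realType. *)
From HB Require Import structures.
From mathcomp Require Import all_boot all_order all_algebra.
From mathcomp Require Import complex.
From mathcomp Require Import all_classical all_reals all_analysis.
Set Implicit Arguments.
Unset Strict Implicit.
Unset Printing Implicit Defensive.
Import Order.TTheory GRing.Theory Num.Theory.
Import numFieldNormedType.Exports.
Local Open Scope classical_set_scope.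
Local Open Scope ring_scope.

(* R[i] packaged as a numClosedFieldType, which is the form in which
   MathComp-Analysis attaches its topology and norm. *)
Definition Cplx (R : realType) : numClosedFieldType := R[i].

(* exp(2 pi i / m) *)
Definition omega (R : realType) (m : nat) : Cplx R :=
  (cos (2 * pi / m%:R) +i* sin (2 * pi / m%:R))%C.

(** * Groups of self-maps *)

(* Elements of a group of transformations are functions T -> T, the product is
   functional composition, and the power g^n is [iter n g]. *)
Definition is_group (T : Type) (H : set (T -> T)) : Prop :=
  [/\ H id,
      forall g h, H g -> H h -> H (g \o h) &
      forall g, H g -> exists g', [/\ H g', g' \o g = id & g \o g' = id]].

Definition subgroup (T : Type) (H G : set (T -> T)) : Prop :=
  is_group H /\ H `<=` G.

Definition normal_subgroup (T : Type) (K G : set (T -> T)) : Prop :=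
  subgroup K G /\
  forall g g' k, G g -> G g' -> g \o g' = id -> g' \o g = id -> K k ->
    K (g \o k \o g').

Definition torsion_free (T : Type) (K : set (T -> T)) : Prop :=
  forall k n, K k -> (0 < n)%N -> iter n k = id -> k = id.

Definition generated (T : Type) (A : set (T -> T)) : set (T -> T) :=
  [set g | forall H, is_group H -> A `<=` H -> H g].

Definition generates (T : Type) (g : T -> T) (H : set (T -> T)) : Prop :=
  H g /\ generated [set g] = H.

Definition stab (T : Type) (G : set (T -> T)) (P : T) : set (T -> T) :=
  [set g | G g /\ g P = P].

(* G = < x_1,...,x_r : x_j^{m_j} = 1, x_1 ... x_r = 1 >, expressed by von Dyck's
   universal property of the group presented by these relators. *)
Definition has_presentation (T : Type) (G : set (T -> T)) (r : nat)
    (m : 'I_r -> nat) (x : 'I_r -> (T -> T)) : Prop :=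
  [/\ generated (range x) = G,
      forall j, iter (m j) (x j) = id,
      \big[(fun g h : T -> T => g \o h) / id]_(j < r) x j = id &
      forall (H : groupType) (h : 'I_r -> H),
        (forall j, h j ^+ m j = 1)%g -> (\prod_(j < r) h j = 1)%g ->
        exists phi : (T -> T) -> H,
          (forall a b, G a -> G b -> phi (a \o b) = (phi a * phi b)%g) /\
          (forall j, phi (x j) = h j)].

(** * Riemann surfaces *)

Definition holomorphic_on (R : realType) (U : set (Cplx R))
    (h : Cplx R -> Cplx R) : Prop :=
  forall z, U z -> derivable h z (1 : Cplx R).

(* A chart is given with an inverse; only the values of cmap on cdom and of
   cinv on cmap @` cdom are meaningful. *)
Record chart (R : realType) (X : Type) := Chart {
  cdom : set X;
  cmap : X -> Cplx R;
  cinv : Cplx R -> X }.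

Section Charts.
Variables (R : realType) (X : topologicalType).

Definition is_chart (c : chart R X) : Prop :=
  [/\ open (cdom c), open (cmap c @` cdom c),
      forall P, cdom c P -> cinv c (cmap c P) = P,
      {within cdom c, continuous (cmap c)} &
      {within cmap c @` cdom c, continuous (cinv c)}].

Definition compatible (c d : chart R X) : Prop :=
  holomorphic_on (cmap c @` (cdom c `&` cdom d)) (cmap d \o cinv c).

End Charts.

Record riemannSurface (R : realType) := RiemannSurface {
  rs_space :> topologicalType;
  rs_atlas : set (chart R rs_space);
  rs_hausdorff : hausdorff_space rs_space;
  rs_connected : connected [set: rs_space];
  rs_nonempty : [set: rs_space] !=set0;
  rs_charts : forall c, rs_atlas c -> is_chart c;
  rs_cover : forall P : rs_space, exists2 c, rs_atlas c & cdom c P;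
  rs_compatible : forall c d, rs_atlas c -> rs_atlas d -> compatible c d }.

Section RiemannSurfaces.
Variable R : realType.
Local Notation C := (Cplx R).
Implicit Types X Y S Q : riemannSurface R.

(* Charts of the maximal atlas. *)
Definition admissible X (c : chart R X) : Prop :=
  is_chart c /\
  forall d, rs_atlas d -> compatible c d /\ compatible d c.

Definition holo_map X Y (f : X -> Y) : Prop :=
  continuous f /\
  forall c d, rs_atlas c -> rs_atlas d ->
    holomorphic_on (cmap c @` (cdom c `&` f @^-1` cdom d))
                   (cmap d \o f \o cinv c).

Definition holo_fun X (V : set X) (h : X -> C) : Prop :=
  forall c, rs_atlas c ->
    holomorphic_on (cmap c @` (cdom c `&` V)) (h \o cinv c).

Definition biholomorphic X Y (f : X -> Y) : Prop :=
  holo_map f /\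
  exists g : Y -> X, [/\ holo_map g, cancel f g & cancel g f].

Definition Aut X : set (X -> X) := [set s | biholomorphic s].

Definition centered_chart X (P : X) (c : chart R X) : Prop :=
  [/\ admissible c, cdom c P & cmap c P = 0].

(* The linear coefficient of the expansion at 0 of phi o s o phi^-1, i.e. the
   complex derivative at 0; it is the same for all charts phi centered at P. *)
Definition delta X (P : X) (s : X -> X) : C :=
  get [set a : C | forall c, centered_chart P c ->
         is_derive (0 : C) (1 : C) (cmap c \o s \o cinv c) a].

(** ** Genus *)

Definition simple_closed_curve X (l : R -> X) : Prop :=
  [/\ {within `[0, 1], continuous l}, l 0 = l 1 &
      {in `[0, 1[ &, injective l}].

(* k pairwise disjoint simple closed curves whose union does not disconnect X *)
Definition nonseparating_system X (k : nat) : Prop :=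
  exists l : 'I_k -> R -> X,
    [/\ forall i, simple_closed_curve (l i),
        forall i j, i != j -> (l i @` `[0, 1]) `&` (l j @` `[0, 1]) = set0 &
        connected (~` \bigcup_i (l i @` `[0, 1]))].

Definition has_genus X (g : nat) : Prop :=
  nonseparating_system X g /\
  forall k, nonseparating_system X k -> (k <= g)%N.

(** ** Quotients and signatures *)

(* (Q, p) is the quotient Riemann surface X / H: p identifies exactly the
   points of the same H-orbit, Q has the quotient topology, and a function on
   an open set of Q is holomorphic iff its pull-back to X is. *)
Definition is_quotient X (H : set (X -> X)) Q (p : X -> Q) : Prop :=
  [/\ forall q, exists P, p P = q,
      forall P P', p P = p P' <-> exists2 h, H h & h P = P',
      forall V : set Q, open V <-> open (p @^-1` V) &
      forall (V : set Q) (u : Q -> C), open V ->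
        (holo_fun V u <-> holo_fun (p @^-1` V) (u \o p))].

(* q is a branch point of p when p is ramified (not locally injective) at some
   point above q. *)
Definition branch_point X Q (p : X -> Q) (q : Q) : Prop :=
  exists2 P, p P = q &
    ~ exists2 U : set X, nbhs P U & {in U &, injective p}.

(* H acts on X with signature (gamma; m_1,...,m_r). *)
Definition has_signature X (H : set (X -> X)) (gamma r : nat)
    (m : 'I_r -> nat) : Prop :=
  exists (Q : riemannSurface R) (p : X -> Q) (b : 'I_r -> Q),
    [/\ is_quotient H p, has_genus Q gamma, injective b,
        forall q, branch_point p q <-> range b q &
        forall j, (2 <= m j)%N /\
          forall P, p P = b j -> (stab H P #= `I_(m j))%card].

End RiemannSurfaces.

Arguments Aut {R} X _.

(* pi : X -> Q is the projection onto Q = X / K, f : Q -> S an isomorphism with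
   inverse f', and theta : Gamma -> G the epimorphism with kernel K given by
   theta(x) = f o x~ o f^-1, x~ being the automorphism of Q induced by x. *)
Definition induced_epimorphism (R : realType) (X Q S : riemannSurface R)
    (Gamma K : set (X -> X)) (G : set (S -> S)) (pi : X -> Q)
    (f : Q -> S) (f' : S -> Q) (theta : (X -> X) -> (S -> S)) : Prop :=
  [/\ theta @` Gamma = G,
      forall x y, Gamma x -> Gamma y -> theta (x \o y) = theta x \o theta y,
      K = [set x | Gamma x /\ theta x = id] &
      forall x, Gamma x -> exists xt : Q -> Q,
        [/\ Aut Q xt, pi \o x = xt \o pi & theta x = f \o xt \o f']].

(** * The unit disk *)

Definition udisk_set (R : realType) : set (Cplx R) := [set z | `|z| < 1].

(* with the topology induced from the complex plane *)
Definition udisk (R : realType) : topologicalType := set_type (@udisk_set R).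

Section UnitDisk.
Variable R : realType.
Local Notation C := (Cplx R).
Local Notation D := (udisk R).
Local Notation A := (@udisk_set R).

Let zero_in_disk : (0 : C) \in A.
Proof. by rewrite inE /udisk_set /= normr0. Qed.

Let zeroD : D := exist _ (0 : C) zero_in_disk.

Definition disk_val (z : D) : C := \val z.

Definition disk_of (w : C) : D := insubd zeroD w.

Definition disk_chart : chart R D := Chart setT disk_val disk_of.

Lemma disk_val_lt1 (z : D) : `|disk_val z| < 1.
Proof. by have := valP z; rewrite inE. Qed.

Lemma disk_valK : cancel disk_val disk_of.
Proof. by move=> z; rewrite /disk_of /disk_val valKd. Qed.

Lemma disk_ofK (w : C) : `|w| < 1 -> disk_val (disk_of w) = w.
Proof. by move=> w1; rewrite /disk_val /disk_of insubdK // inE. Qed.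

Lemma disk_val_continuous : continuous disk_val.
Proof. exact: initial_continuous. Qed.

Lemma disk_val_image : disk_val @` setT = A.
Proof.
apply/seteqP; split=> [_ [z _ <-]|w Aw]; first exact: disk_val_lt1.
by exists (disk_of w) => //; exact: disk_ofK.
Qed.

Lemma udisk_set_open : open A.
Proof.
rewrite (_ : A = ball (0 : C) (1 : C)); first exact: ball_open.
by apply/seteqP; split=> z /=; rewrite -ball_normE /= sub0r normrN.
Qed.

Lemma disk_of_continuous : {within A, continuous disk_of}.
Proof.
apply/subspace_sigL_continuousP.
suff -> : sigL A disk_of = id by move=> x; exact: cvg_id.
by apply/funext => z; rewrite /sigL /=; exact: disk_valK.
Qed.

Lemma real_complex_continuous : continuous (fun t : R => (t%:C)%C : C).
Proof.
move=> t; apply/cvgrPdist_lt => e e0.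
have [d d0 ->] : exists2 d : R, 0 < d & e = (d%:C)%C :> C.
  exists (complex.Re e); last by apply/esym/RRe_real; rewrite gtr0_real.
  by have := e0; rewrite ltcE /= => /andP[].
apply: filterS (nbhsx_ballx t d d0) => s; rewrite -ball_normE /= => ts.
suff -> : `|((t%:C)%C : C) - (s%:C)%C| = (`|t - s|%:C)%C by rewrite ltcR.
transitivity (`|((t - s)%:C)%C : C|).
  by congr (`|_|); exact: esym (rmorphB (real_complex R) t s).
by rewrite [LHS]normc_def /= expr0n addr0 sqrtr_sqr.
Qed.

Lemma udisk_hausdorff : hausdorff_space D.
Proof.
move=> x y xy; apply/(can_inj disk_valK)/(@norm_hausdorff _ C) => U V.
move=> /disk_val_continuous Ux /disk_val_continuous Vy.
have [z [Uz Vz]] := xy _ _ Ux Vy.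
by exists (disk_val z).
Qed.

Lemma udisk_connected : connected [set: D].
Proof.
pose ray (z : D) (t : R) : C := (t%:C)%C * disk_val z.
pose arc (z : D) : set D := (disk_of \o ray z) @` `[0, 1].
have -> : [set: D] = \bigcup_(z in setT) arc z.
  apply/seteqP; split=> // z _; exists z => //; exists 1.
    by rewrite /= in_itv /= ler01 lexx.
  by rewrite /ray /= mul1r disk_valK.
apply: bigcup_connected => [|z _].
  exists zeroD => z _; exists 0; first by rewrite /= in_itv /= ler01 lexx.
  by rewrite /ray /= mul0r; exact: (disk_valK zeroD).
apply: connected_continuous_connected; first exact: segment_connected.
apply: continuous_in_subspaceT => t /set_mem /=; rewrite in_itv /= => /andP[t0 t1].
have Aray : A (ray z t).
  rewrite /udisk_set /ray /= normrM ger0_norm ?lecR //.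
  apply: (le_lt_trans _ (disk_val_lt1 z)).
  by rewrite ler_piMl ?normr_ge0 // (_ : 1 = (1%:C)%C) // lecR.
apply: continuous_comp.
  apply: (@cvgMr_tmp C R); exact: real_complex_continuous.
have := disk_of_continuous; rewrite continuous_open_subspace; last exact: udisk_set_open.
by apply; rewrite inE.
Qed.

Lemma disk_chart_is_chart : is_chart disk_chart.
Proof.
split=> /=; rewrite ?disk_val_image.
- exact: openT.
- exact: udisk_set_open.
- by move=> P _; exact: disk_valK.
- exact: (@continuous_subspaceT D C setT disk_val disk_val_continuous).
- exact: disk_of_continuous.
Qed.

Lemma disk_chart_compatible : compatible disk_chart disk_chart.
Proof.
rewrite /compatible /= setTI disk_val_image => z Az.
apply: (@near_eq_derivable _ _ _ id); last exact: derivable_id.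
apply: filterS (open_nbhs_nbhs (conj udisk_set_open Az)) => w Aw.
exact: (esym (disk_ofK Aw)).
Qed.

Definition Disk : riemannSurface R.
Proof.
apply: (@RiemannSurface R D [set disk_chart]).
- exact: udisk_hausdorff.
- exact: udisk_connected.
- by exists zeroD.
- by move=> _ ->; exact: disk_chart_is_chart.
- by move=> P; exists disk_chart.
- by move=> _ _ -> ->; exact: disk_chart_compatible.
Defined.

(** ** Moebius self-maps and Fuchsian groups *)

(* g is z |-> (a z + b) / (conj b z + conj a), with |a|^2 - |b|^2 = 1; the
   pair (a, b) is unique up to sign. *)
Definition moebius (a b : C) (g : D -> D) : Prop :=
  a * a^* - b * b^* = 1 /\
  forall z, disk_val (g z) =
    (a * disk_val z + b) / (b^* * disk_val z + a^*).

Definition AutD : set (D -> D) := [set g | exists a b, moebius a b g].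

(* the identity is isolated in the matrix topology *)
Definition discrete_in_AutD (G : set (D -> D)) : Prop :=
  exists2 e : C, 0 < e &
    forall a b g, G g -> moebius a b g -> `|a - 1| < e -> `|b| < e -> g = id.

Definition parabolic (g : D -> D) : Prop :=
  g <> id /\ exists a b, moebius a b g /\ (a + a^*) ^+ 2 = 4.

Definition limit_set (G : set (D -> D)) : set C :=
  [set w | exists z, limit_point [set disk_val (g z) | g in G] w].

Definition fuchsian (G : set (D -> D)) : Prop :=
  [/\ subgroup G AutD, discrete_in_AutD G,
      exists n (x : 'I_n -> (D -> D)), generated (range x) = G,
      forall g, G g -> ~ parabolic g &
      limit_set G = [set w | `|w| = 1]].

Definition positive_minimal_rotation (m : nat) (x : D -> D) : Prop :=
  exists g g', [/\ AutD g, AutD g', cancel g g', cancel g' g &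
    forall z, disk_val (g (x (g' z))) = omega R m * disk_val z].

(** ** The canonical polygon *)

(* The hyperbolic geodesic segment [a, b]: w |-> (w - a) / (1 - conj a w) is a
   Moebius self-map sending a to 0, and geodesics from 0 are radii. *)
Definition geodesic_segment (a b : D) : set D :=
  let T (w : D) :=
    (disk_val w - disk_val a) / (1 - (disk_val a)^* * disk_val w) in
  [set w | exists2 t : R, 0 <= t <= 1 & T w = (t%:C)%C * T b].

(* F is the closed region bounded by the simple hyperbolic polygon with
   successive vertices p_0, ..., p_(n-1). *)
Definition hyperbolic_polygon (n : nat) (p : 'I_n -> D) (F : set D) : Prop :=
  let side i := geodesic_segment (p i) (p (ordS i)) in
  [/\ injective p,
      forall i j, i != j -> side i `&` side j =
        [set p i; p (ordS i)] `&` [set p j; p (ordS j)],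
      compact F, closure F^° = F & F `\` F^° = \bigcup_i side i].

Definition fundamental_region (G : set (D -> D)) (F : set D) : Prop :=
  (forall g, G g -> g <> id -> (g @` F^°) `&` F^° = set0) /\
  \bigcup_(g in G) (g @` F) = setT.

(* The canonical polygon in genus 0 has 2r vertices v_0, z_0, v_1, z_1, ...,
   v_(r-1), z_(r-1); x_j fixes z_j and maps the side [z_j, v_(j+1)] onto the
   preceding side [z_j, v_j]. *)
Definition canonical_polygon (G : set (D -> D)) (r : nat)
    (x : 'I_r -> (D -> D)) : Prop :=
  exists (p : 'I_(r.*2) -> D) (F : set D),
    [/\ hyperbolic_polygon p F, fundamental_region G F &
        forall (j : 'I_r) (k : 'I_(r.*2)), k = j.*2.+1 :> nat ->
          x j (p k) = p k /\ x j (p (ordS k)) = p (ord_pred k)].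

Definition canonical_generators (G : set (D -> D)) (r : nat)
    (m : 'I_r -> nat) (x : 'I_r -> (D -> D)) : Prop :=
  [/\ has_presentation G m x, canonical_polygon G x &
      forall j, positive_minimal_rotation (m j) (x j)].

End UnitDisk.

(* Main.v *)
Require Import Defs.
From HB Require Import structures.
From mathcomp Require Import all_boot all_order all_algebra.
From mathcomp Require Import complex.
From mathcomp Require Import all_classical all_reals all_analysis.
From mathcomp Require Import ring lra.
Set Implicit Arguments.
Unset Strict Implicit.
Unset Printing Implicit Defensive.
Import Order.TTheory GRing.Theory Num.Theory.
Import numFieldNormedType.Exports.
Local Open Scope classical_set_scope.
Local Open Scope ring_scope.

(** Why the theorem holds.  Let z be the fixed point of x_j and P its image in S.

    Two facts about the point P carry the proof.  The first is that its
    stabilizer in G is cyclic of order m_j, generated by s = theta(x_j).  If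
    theta(y) fixes P, then y moves z inside its K-orbit, so that k o y fixes z
    for some k in K, and theta(k o y) = theta(y); hence the stabilizer of P is
    the image of the stabilizer of z in Gamma.  The latter is generated by x_j
    because of the canonical polygon: x_j turns one of the two sides that end at
    z onto the other one, by the angle 2 pi / m_j, and an element of Gamma that
    turned by a smaller nonzero angle would send some interior point of the
    polygon to an interior point ([no_small_rotation], [stab_canonical_generator]).

    The second is that delta_P(s^n) = omega^n.  The projection from the disk to
    S is locally biholomorphic at z, and it conjugates x_j^n to s^n, so that both
    maps have the same derivative at their fixed points; x_j is conjugate to the
    multiplication by omega.  For the local invertibility one uses that K acts
    freely: an element of K that fixes z is a power of x_j, hence of finite
    order, and K is torsion free.  As K is discrete, z then has a neighbourhood
    whose K-translates are disjoint ([wandering_nbhs]), the projection has a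
    local section there ([quotient_local_section]), and this section is
    holomorphic because a function on D / K is holomorphic as soon as its
    pull-back to the disk is.

    The rest is arithmetic modulo m_j: tau = s^q and s = tau^k give
    omega = delta_P(s) = omega^(k q), i.e. k q = 1 modulo m_j, and
    delta_P(tau) = omega^q. *)

(** * The unit circle *)

Section UnitCircle.
Variable R : realType.
Local Notation C := (Cplx R).
Implicit Types t s : R.

Definition circle t : C := (cos t +i* sin t)%C.

Lemma circleD s t : circle (s + t) = circle s * circle t.
Proof.
apply/eqP; rewrite eq_complex /= cosD sinD eqxx /=.
by apply/eqP; rewrite addrC; congr (_ + _); rewrite mulrC.
Qed.

Lemma circle0 : circle 0 = 1.
Proof. by rewrite /circle cos0 sin0. Qed.

Lemma norm_circle t : `|circle t| = 1.
Proof. by rewrite normc_def /= cos2Dsin2 sqrtr1. Qed.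

Lemma circle_neq0 t : circle t != 0.
Proof. by rewrite -normr_eq0 norm_circle oner_neq0. Qed.

Lemma circleMn t n : circle (t *+ n) = circle t ^+ n.
Proof.
by elim: n => [|n IHn]; rewrite ?mulr0n ?circle0 // mulrS exprS circleD IHn.
Qed.

Lemma omegaE n : omega R n = circle (2 * pi / n%:R).
Proof. by []. Qed.

Lemma circle_2pi : circle (2 * pi) = 1.
Proof. by rewrite /circle mulr_natl cos2pi sin2pi. Qed.

Lemma circle_2piz (k : int) : circle (2 * pi * k%:~R) = 1.
Proof.
have pos n : circle (2 * pi * n%:R) = 1.
  by rewrite mulr_natr circleMn circle_2pi expr1n.
case: k => n; first exact: pos.
apply: (mulfI (circle_neq0 (2 * pi * n.+1%:R))).
by rewrite -circleD NegzE mulrNz mulrN subrr circle0 pos mulr1.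
Qed.

(** cos t = 1 - 2 sin(t / 2)^2 with sin(t / 2) > 0. *)
Lemma circle_neq1 t : 0 < t < 2 * pi -> circle t != 1.
Proof.
move=> /andP[t0 t2]; apply/eqP => /(congr1 (@complex.Re R)) /= ct.
have st : 0 < sin (t / 2).
  by apply: sin_gt0_pi; rewrite divr_gt0 //= ltr_pdivrMr // mulrC.
have := cos_mulr2n (t / 2); rewrite -[X in cos X]mulr_natr divfK ?pnatr_eq0 // ct.
rewrite cos2sin2 => e.
have : 0 < sin (t / 2) ^+ 2 by rewrite exprn_gt0.
lra.
Qed.

Lemma circle_eq1P t : circle t = 1 <-> exists k : int, t = 2 * pi * k%:~R.
Proof.
split=> [e|[k ->]]; last exact: circle_2piz.
have pi2 : 0 < 2 * pi :> R by rewrite mulr_gt0 ?pi_gt0.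
pose k := Num.floor (t / (2 * pi)); exists k.
pose u := t - 2 * pi * k%:~R.
have cu : circle u = 1.
  by rewrite /u circleD e mul1r -mulrN -mulrNz circle_2piz.
have /andP[k0 k1] : k%:~R <= t / (2 * pi) < (k + 1)%:~R.
  exact: floor_itv.
have u0 : 0 <= u by rewrite subr_ge0 mulrC -ler_pdivlMr.
have u1 : u < 2 * pi.
  by rewrite ltrBlDl -{2}[2 * pi]mulr1 -mulrDr mulrC -ltr_pdivrMr // -[1]/(1%:~R) -intrD.
have [u_eq0|u_neq0] := eqVneq u 0; first by apply/eqP; rewrite -subr_eq0 -/u u_eq0.
by have := circle_neq1; move=> /(_ u); rewrite lt0r u_neq0 u0 u1 cu eqxx => /(_ isT).
Qed.

Lemma unit_circle_surj (w : C) : `|w| = 1 -> exists t, w = circle t.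
Proof.
case: w => a b; rewrite normc_def /= => /(congr1 (@complex.Re R)) /= ab1.
have {}ab1 : a ^+ 2 + b ^+ 2 = 1.
  by have := sqr_sqrtr (addr_ge0 (sqr_ge0 a) (sqr_ge0 b)); rewrite ab1 expr1n.
have a1 : -1 <= a <= 1.
  rewrite -ler_norml -(@ler_pXn2r _ 2) ?nnegrE // real_normK ?num_real // expr1n.
  by rewrite -ab1 lerDl sqr_ge0.
have sa : sin (acos a) = `|b| by rewrite sin_acos // -sqrtr_sqr -ab1; congr Num.sqrt; ring.
have [b0|b0] := leP 0 b.
  by exists (acos a); rewrite /circle acosK ?in_itv //= sa ger0_norm.
exists (- acos a); rewrite /circle cosN sinN acosK ?in_itv //= sa ltr0_norm //.
by rewrite opprK.
Qed.

Lemma circle_polar (w : C) : exists t, w = `|w| * circle t.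
Proof.
have [->|w0] := eqVneq w 0; first by exists 0; rewrite normr0 mul0r.
have [|t wt] := @unit_circle_surj (w / `|w|).
  by rewrite normrM normfV normr_id divff // normr_eq0.
by exists t; rewrite -wt mulrC divfK // normr_eq0.
Qed.

Lemma circle_mod (a t : R) :
  exists2 u, a <= u < a + 2 * pi & circle u = circle t.
Proof.
have pi2 : 0 < 2 * pi :> R by rewrite mulr_gt0 ?pi_gt0.
pose k := Num.floor ((t - a) / (2 * pi)).
have /andP[k0 k1] : k%:~R <= (t - a) / (2 * pi) < (k + 1)%:~R.
  exact: floor_itv.
exists (t - 2 * pi * k%:~R); last first.
  by rewrite circleD -mulrN -mulrNz circle_2piz mulr1.
move: k0 k1; rewrite ler_pdivlMr // ltr_pdivrMr // intrD => k0 k1.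
by apply/andP; split; lra.
Qed.

Lemma omegaX_eq1 n k : (0 < n)%N -> omega R n ^+ k = 1 <-> (n %| k)%N.
Proof.
move=> n0; rewrite omegaE -circleMn circle_eq1P.
have nR : n%:R != 0 :> R by rewrite pnatr_eq0 -lt0n.
have pi2 : 2 * pi != 0 :> R by rewrite mulf_neq0 ?pnatr_eq0 // gt_eqF // pi_gt0.
split=> [[q e]|/dvdnP[q ->]]; last first.
  exists q%:Z; rewrite mulrnA -mulr_natr -[_ *+ q]mulr_natr.
  by rewrite -pmulrn; field.
have : (k%:R : R) = q%:~R * n%:R.
  apply: (mulfI pi2); rewrite [RHS]mulrA -e -mulr_natr; field; exact: nR.
rewrite -[k%:R]/(k%:Z%:~R) -[n%:R]/(n%:Z%:~R) -intrM => /eqP.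
rewrite eqr_int => /eqP kq.
by apply/dvdnP; exists `|q|%N; rewrite -[k]/(`|k%:Z|%N) kq abszM.
Qed.

Lemma omegaX_eq n i k : (0 < n)%N ->
  omega R n ^+ i = omega R n ^+ k <-> i = k %[mod n].
Proof.
move=> n0; wlog le_ik : i k / (i <= k)%N => [hw|].
  have [/hw //|/ltnW/hw e] := leqP i k.
  by split=> h; apply/esym; apply/e.
have o0 : omega R n ^+ i != 0 by rewrite expf_neq0 ?omegaE ?circle_neq0.
rewrite -{1}(subnKC le_ik) exprD.
split=> [h|/esym/eqP]; last first.
  by rewrite eqn_mod_dvd // => /omegaX_eq1 -> //; rewrite mulr1.
apply/esym/eqP; rewrite eqn_mod_dvd //; apply/omegaX_eq1 => //.
by apply: (mulfI o0); rewrite mulr1 -h.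
Qed.

Lemma complex_continuous :
  continuous (fun p : R * R => (p.1 +i* p.2)%C : C).
Proof.
move=> [a b]; pose h := (fun p : R * R => (p.1%:C)%C + 'i%C * (p.2%:C)%C : C).
rewrite [X in continuous_at _ X](_ : _ = h); last first.
  by apply/funext => -[u v]; exact: (complexE (u +i* v)%C).
apply: (@cvgD C C).
  apply: (cvg_comp fst (fun t : R => (t%:C)%C : C)); first exact: cvg_fst.
  exact: real_complex_continuous.
apply: (@cvgMl_tmp C); apply: (cvg_comp snd (fun t : R => (t%:C)%C : C)).
  exact: cvg_snd.
exact: real_complex_continuous.
Qed.

Lemma circle_continuous : continuous circle.
Proof.
move=> t; have hc : (cos u, sin u) @[u --> nbhs t] --> (cos t, sin t).
  exact: (cvg_pair (@continuous_cos R t) (@continuous_sin R t)).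
exact: (cvg_comp _ _ hc (@complex_continuous (cos t, sin t))).
Qed.

End UnitCircle.

(** * Moebius self-maps of the disk *)

Section Moebius.
Variable R : realType.
Local Notation C := (Cplx R).
Local Notation D := (udisk R).
Implicit Types (a b c d : C) (g h : D -> D).

Lemma disk_val_inj : injective (@disk_val R).
Proof. exact: can_inj (@disk_valK R). Qed.

Lemma norm_moebius_coef a b : a * a^* - b * b^* = 1 -> `|a| ^+ 2 = 1 + `|b| ^+ 2.
Proof. by rewrite !normCK => <-; rewrite subrK. Qed.

(** Since |a| > |b|, the pole of a Moebius self-map lies outside the disk. *)
Lemma moebius_den_neq0 a b (z : C) :
  a * a^* - b * b^* = 1 -> `|z| < 1 -> b^* * z + a^* != 0.
Proof.
move=> /norm_moebius_coef ab z1; apply/negP; rewrite addr_eq0 => /eqP e.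
have {}e : `|b| * `|z| = `|a| by rewrite -norm_conjC -normrM e normrN norm_conjC.
have : `|a| ^+ 2 <= `|b| ^+ 2.
  by rewrite -e ler_pXn2r ?nnegrE ?mulr_ge0 // ler_piMr // ltW.
by rewrite ab gerDr ler10.
Qed.

(** Composition is the product of the matrices with rows (a, b) and
    (conj b, conj a). *)
Lemma moebius_comp a b c d g h : moebius a b g -> moebius c d h ->
  moebius (a * c + b * d^*) (a * d + b * c^*) (g \o h).
Proof.
move=> [ab gE] [cd hE]; split.
  by rewrite !(rmorphD, rmorphM) /= !conjCK -[RHS]mul1r -{1}ab -cd; ring.
move=> z; rewrite /= gE hE !(rmorphD, rmorphM) /= !conjCK.
have z1 := disk_val_lt1 z; have n1 := moebius_den_neq0 cd z1.
have n2 : b^* * ((c * disk_val z + d) / (d^* * disk_val z + c^*)) + a^* != 0.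
  by rewrite -hE; apply: moebius_den_neq0 => //; exact: disk_val_lt1.
move: n1 n2; set u := disk_val z; move=> n1 n2.
have n3 : (a^* * d^* + b^* * c) * u + (a^* * c^* + b^* * d) != 0.
  suff -> : (a^* * d^* + b^* * c) * u + (a^* * c^* + b^* * d) =
    (b^* * ((c * u + d) / (d^* * u + c^*)) + a^*) * (d^* * u + c^*) by rewrite mulf_neq0.
  by field.
by field; apply/andP; split; [exact: n3|exact: n1].
Qed.

(** The inverse of a Moebius self-map, with the coefficients of the adjugate
    matrix. *)
Lemma moebius_can a b g h : moebius a b g -> cancel h g -> moebius a^* (- b) h.
Proof.
move=> [ab gE] hK; split=> [|w]; first by rewrite rmorphN /= conjCK -ab; ring.
rewrite -{2 3}(hK w) gE rmorphN /= conjCK.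
have n1 := moebius_den_neq0 ab (disk_val_lt1 (h w)).
move: n1; set u := disk_val (h w); move=> n1.
have -> : - b^* * ((a * u + b) / (b^* * u + a^*)) + a = (b^* * u + a^*)^-1.
  by rewrite -[RHS]mul1r -ab; field; exact: n1.
have -> : a^* * ((a * u + b) / (b^* * u + a^*)) + - b = u * (b^* * u + a^*)^-1.
  by rewrite -[RHS]mul1r -ab; field; exact: n1.
by rewrite mulfK // invr_neq0.
Qed.

Lemma AutD_comp g h : AutD g -> AutD h -> AutD (g \o h).
Proof. by move=> [a [b gm]] [c [d hm]]; do 2!eexists; exact: moebius_comp gm hm. Qed.

Lemma AutD_can g h : AutD g -> cancel h g -> AutD h.
Proof. by move=> [a [b gm]] hK; do 2!eexists; exact: moebius_can gm hK. Qed.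

Lemma disk_continuous (T : topologicalType) (h : T -> D) (t : T) :
  {for t, continuous (@disk_val R \o h)} -> {for t, continuous h}.
Proof.
move=> hc; have -> : h = @disk_of R \o (@disk_val R \o h).
  by apply/funext => s /=; rewrite disk_valK.
apply: continuous_comp; first exact: hc.
have := @disk_of_continuous R; rewrite continuous_open_subspace; last exact: udisk_set_open.
by apply; rewrite inE; exact: disk_val_lt1.
Qed.

Lemma moebius_fun_derivable a b c d (z : C) : c * z + d != 0 ->
  derivable (fun u : C => (a * u + b) / (c * u + d)) z 1.
Proof.
have aff p q : derivable (fun u : C => p * u + q) z 1.
  apply: derivableD; last exact: derivable_cst.
  by apply: derivableM; [exact: derivable_cst|exact: derivable_id].
move=> n; apply: derivableM; first exact: aff.
by apply: derivableV => //; exact: aff.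
Qed.

Lemma AutD_continuous g : AutD g -> continuous g.
Proof.
move=> [a [b [ab gE]]] z; apply: disk_continuous.
rewrite (_ : _ \o _ = (fun u : C => (a * u + b) / (b^* * u + a^*)) \o @disk_val R).
  apply: continuous_comp; first exact: disk_val_continuous.
  apply/differentiable_continuous/derivable1_diffP/moebius_fun_derivable.
  by apply: moebius_den_neq0 => //; exact: disk_val_lt1.
by apply/funext => w /=; exact: gE.
Qed.

(** y is the hyperbolic rotation of angle t about the point that the coordinate
    g sends to 0; the angle only matters modulo 2 pi. *)
Definition rotates g (t : R) (y : D -> D) : Prop :=
  forall w, disk_val (g (y w)) = circle t * disk_val (g w).

Lemma rotates_comp g s t y y' :
  rotates g s y -> rotates g t y' -> rotates g (s + t) (y \o y').
Proof. by move=> ys yt w; rewrite /= ys yt circleD mulrA. Qed.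

Lemma rotates_iter g t y n : rotates g t y -> rotates g (t *+ n) (iter n y).
Proof.
move=> yt; elim: n => [|n IHn] w; first by rewrite mulr0n circle0 mul1r.
by rewrite mulrS; exact: (rotates_comp yt IHn).
Qed.

Lemma rotates_inj g t y y' : injective g ->
  rotates g t y -> rotates g t y' -> y = y'.
Proof.
by move=> gI yt yt'; apply/funext => w; apply/gI/disk_val_inj; rewrite yt yt'.
Qed.

(** Read in the coordinate g, y is a Moebius self-map
    (a w + b) / (conj b w + conj a) that fixes 0; so b = 0, and y is the
    multiplication by a / conj a, which has modulus 1. *)
Lemma stab_rotates g g' y z0 : AutD g -> cancel g g' -> cancel g' g ->
  disk_val (g z0) = 0 -> AutD y -> y z0 = z0 -> exists t, rotates g t y.
Proof.
move=> gA gK g'K gz yA yz.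
have [a [b [ab hE]]] : AutD (g \o (y \o g')).
  by apply: AutD_comp => //; apply: AutD_comp => //; exact: AutD_can g'K.
have := hE (g z0); rewrite /= gK yz gz !mulr0 !add0r => /esym/eqP.
have a0 : a^* != 0.
  by have := moebius_den_neq0 ab (disk_val_lt1 (g z0)); rewrite gz mulr0 add0r.
rewrite mulf_eq0 invr_eq0 (negPf a0) orbF => /eqP b0.
move: ab; rewrite b0 mul0r subr0 => aa.
have [t at_] : exists t, a / a^* = circle t.
  apply: unit_circle_surj; rewrite normrM normfV norm_conjC divff //.
  by rewrite normr_eq0 -conjC_eq0.
exists t => w; have := hE (g w); rewrite /= gK b0 rmorph0 mul0r add0r addr0 => ->.
by rewrite mulrAC at_.
Qed.

End Moebius.

(** * Corners of a hyperbolic polygon *)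

Section Groups.
Variable T : Type.
Implicit Types (G A : set (T -> T)) (g : T -> T).

Lemma group_iter G g n : is_group G -> G g -> G (iter n g).
Proof.
by move=> [G1 GM _] Gg; elim: n => [//|n IHn]; exact: (GM g (iter n g)).
Qed.

Lemma generated_sub A : A `<=` generated A.
Proof. by move=> g Ag H _; apply. Qed.

End Groups.

Section Corner.
Variable R : realType.
Local Notation C := (Cplx R).
Local Notation D := (udisk R).
Implicit Types (a b w : D) (g h : D -> D).

(** The coordinate (w - a) / (1 - a^* w) that defines geodesic segments from a is,
    up to a constant factor, the only Moebius coordinate that vanishes at a.
    Hence such segments are radii in each of these coordinates. *)
Lemma moebius_coordinateE g a : AutD g -> disk_val (g a) = 0 -> exists k : C, forall w,
  disk_val (g w) =
  k * ((disk_val w - disk_val a) / (1 - (disk_val a)^* * disk_val w)).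
Proof.
move=> [al [be [ab gE]]] ga; have n := moebius_den_neq0 ab (disk_val_lt1 a).
have be_eq : be = - (al * disk_val a).
  apply/eqP; rewrite -addr_eq0 addrC; apply/eqP.
  by move: ga; rewrite gE => /eqP; rewrite mulf_eq0 invr_eq0 (negPf n) orbF => /eqP.
have al0 : al^* != 0.
  apply: contraNneq n => al0; rewrite be_eq rmorphN rmorphM /= al0.
  by rewrite mul0r oppr0 mul0r addr0.
exists (al / al^*) => w; have := moebius_den_neq0 ab (disk_val_lt1 w).
rewrite gE be_eq rmorphN rmorphM /=.
have -> : - (al^* * (disk_val a)^*) * disk_val w + al^* =
  al^* * (1 - (disk_val a)^* * disk_val w) by ring.
rewrite mulf_eq0 negb_or al0 /= => n1.
by field; apply/andP; split; [exact: n1|exact: al0].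
Qed.

Lemma geodesic_source g a b w : AutD g -> disk_val (g a) = 0 ->
  geodesic_segment a b w ->
  exists2 s : C, 0 <= s & disk_val (g w) = s * disk_val (g b).
Proof.
move=> gA /(moebius_coordinateE gA)[k gE] [t /andP[t0 _] e].
by exists (t%:C)%C; rewrite ?lecR // !gE e mulrCA.
Qed.

(** Segments are defined from their source; that they are radii around their
    target as well comes down to the following.  If w is the point of parameter
    t of [a, b], then
    (w - b) / (1 - b^* w) = s (a - b) / (1 - b^* a) with
    s = (1 - t) N / (N - t M), where N = |1 - a^* b|^2 and M = |b - a|^2, and
    M < N because N - M = (1 - |a|^2) (1 - |b|^2). *)
Lemma geodesic_target g a b w : AutD g -> disk_val (g b) = 0 ->
  geodesic_segment a b w ->
  exists2 s : C, 0 <= s & disk_val (g w) = s * disk_val (g a).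
Proof.
move=> gA /(moebius_coordinateE gA)[k gE] [t01 t01P]; rewrite !gE.
have den0 u v : 1 - (disk_val u)^* * disk_val v != 0 :> C.
  rewrite subr_eq0; apply/negP => /eqP /(congr1 (@Num.norm _ _)) /eqP.
  rewrite normr1 normrM norm_conjC eq_sym lt_eqF //.
  by rewrite mulr_ilt1 // ?normr_ge0 //; exact: disk_val_lt1.
have lt1 u : (disk_val u) * (disk_val u)^* < 1 :> C.
  by rewrite -normCK expr_lt1 //; exact: disk_val_lt1.
have [t [t0 t1 ->]] : exists t : C, [/\ 0 <= t, t <= 1 & (t01%:C)%C = t].
  case/andP: t01P => h0 h1; exists (t01%:C)%C; split=> //; first by rewrite lecR.
  by rewrite (_ : 1 = (1%:C)%C) // lecR.
move: (den0 a w) (den0 a b) (den0 b w) (den0 b a) (lt1 a) (lt1 b).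
set A := disk_val a; set B := disk_val b; set W := disk_val w.
move=> naw nab nbw nba la lb E.
pose N := (1 - A^* * B) * (1 - B^* * A); pose M := (B - A) * (B^* - A^*).
have NE : N = `|1 - A^* * B| ^+ 2.
  by rewrite normCK rmorphB rmorphM /= conjCK rmorph1 [A * _]mulrC.
have ME : M = `|B - A| ^+ 2 by rewrite normCK rmorphB.
have NM : N - M = (1 - A * A^*) * (1 - B * B^*) by rewrite /N /M; ring.
have NMgt0 : 0 < N - M by rewrite NM mulr_gt0 ?subr_gt0.
have M0 : 0 <= M by rewrite ME exprn_ge0.
have NtM : 0 < N - t * M.
  apply: lt_le_trans NMgt0 _; rewrite lerD2l lerN2.
  by rewrite ler_piMl.
have {}E : (W - A) * (1 - A^* * B) = t * (B - A) * (1 - A^* * W).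
  by move/eqP: E; rewrite mulrA eqr_div // => /eqP.
(* dlt is the coefficient of w when the equation E is solved for w *)
pose dlt := 1 - A^* * B + t * A^* * (B - A).
have e1 : dlt * (W - B) = (A - B) * (1 - A^* * B) * (1 - t).
  have -> : dlt * (W - B) = (W - A) * (1 - A^* * B) + t * (B - A) * (A^* * W)
     + (A - dlt * B - A * A^* * B) by rewrite /dlt; ring.
  by rewrite E /dlt; ring.
have e2 : dlt * (1 - B^* * W) = N - t * M.
  have -> : dlt * (1 - B^* * W) = dlt - B^* * ((W - A) * (1 - A^* * B)
    + t * (B - A) * (A^* * W) + A * (1 - A^* * B)) by rewrite /dlt; ring.
  by rewrite E /dlt /N /M; ring.
have dlt0 : dlt != 0.
  by apply: contraTneq NtM => d0; rewrite -e2 d0 mul0r ltxx.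
exists ((1 - t) * N / (N - t * M)).
  apply: divr_ge0; last exact: ltW.
  by apply: mulr_ge0; rewrite ?subr_ge0 // NE exprn_ge0.
rewrite [RHS]mulrCA; congr (_ * _).
have -> : W - B = (A - B) * (1 - A^* * B) * (1 - t) / dlt by rewrite -e1 mulrAC divff // mul1r.
have -> : 1 - B^* * W = (N - t * M) / dlt by rewrite -e2 mulrAC divff // mul1r.
move: (NtM) => /lt0r_neq0 n0.
have -> : N = (1 - A^* * B) * (1 - B^* * A) by [].
by field; apply/and3P; split; [exact: nba|exact: n0|exact: dlt0].
Qed.


Lemma geodesic_closed a b : closed (geodesic_segment a b).
Proof.
pose T (w : D) :=
  (disk_val w - disk_val a) / (1 - (disk_val a)^* * disk_val w).
pose ray (t : R) : C := (t%:C)%C * T b.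
have -> : geodesic_segment a b = T @^-1` (ray @` `[0, 1]).
  apply/seteqP; split=> w /=.
    by move=> [t t01 e]; exists t; rewrite ?in_itv.
  by move=> [t]; rewrite in_itv /= => t01 e; exists t => //; rewrite -/(T w) -e.
have Tc : continuous T.
  pose M (u : C) : C := (1 * u + - disk_val a) / (- (disk_val a)^* * u + 1).
  have -> : T = M \o @disk_val R.
    by apply/funext => w; rewrite /T /M /= mul1r mulNr [_ + 1]addrC.
  move=> w; apply: continuous_comp; first exact: disk_val_continuous.
  apply/differentiable_continuous/derivable1_diffP/moebius_fun_derivable.
  rewrite mulNr addrC subr_eq0; apply/negP => /eqP /(congr1 (@Num.norm _ _)) /eqP.
  rewrite normr1 normrM norm_conjC eq_sym lt_eqF //.
  by rewrite mulr_ilt1 // ?normr_ge0 //; exact: disk_val_lt1.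
apply: closed_comp => [w _|]; first exact: Tc.
apply: compact_closed; first exact: norm_hausdorff.
apply: continuous_compact; last exact: segment_compact.
apply: continuous_subspaceT => t; apply: (@cvgMr_tmp C R).
exact: real_complex_continuous.
Qed.

(** The two sides that end at the vertex are radii around it, and they cut each
    small circle around it into an arc of angle theta and one of angle
    2 pi - theta >= theta.  The interior of the polygon meets one of these circles
    and, being open and closed off the boundary, contains one of the two arcs.  A
    rotation about the vertex by an angle phi < theta sends some point of this arc
    to another one, against the disjointness of the translates of the
    interior. *)
Lemma no_small_rotation n (p : 'I_n -> D) F (G : set (D -> D)) (k : 'I_n)
    g g' (theta phi : R) y :
  hyperbolic_polygon p F -> fundamental_region G F ->
  AutD g -> cancel g g' -> cancel g' g -> disk_val (g (p k)) = 0 ->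
  0 < theta <= pi ->
  disk_val (g (p (ord_pred k))) = circle theta * disk_val (g (p (ordS k))) ->
  G y -> rotates g phi y -> 0 < phi < theta -> False.
Proof.
move=> [p_inj sides F_cpt F_reg F_bd] [Fdisj _] gA gK g'K gp.
move=> /andP[theta0 theta_pi] corner Gy y_rot /andP[phi0 phi_theta].
set q := disk_val (g (p (ordS k))) in corner.
have [be qE] := circle_polar q.
have g'A := AutD_can gA g'K.
pose side i := geodesic_segment (p i) (p (ordS i)).
have vertex_side i : side i (p i).
  by exists 0; rewrite ?lexx ?ler01 // !subrr !mul0r.
have side_bd i w : side i w -> ~ interior F w.
  move=> sw; have : (F `\` interior F) w by rewrite F_bd; exists i.
  by case.
(* only the two sides that end at the vertex come close to it *)
have far_sides : \forall w \near p k,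
    forall i, i != k -> i != ord_pred k -> ~ side i w.
  apply: (@filter_forall _ _ (fun i w => i != k -> i != ord_pred k -> ~ side i w)
    (nbhs (p k)) (nbhs_filter (p k))) => i.
  have [->|ik] := eqVneq i k; first by apply: filterE => w; rewrite ?eqxx.
  have [->|ik'] := eqVneq i (ord_pred k); first by apply: filterE => w; rewrite ?eqxx.
  suff : \forall w \near p k, ~ side i w by apply: filterS.
  apply: open_nbhs_nbhs; split; first exact/closed_openC/geodesic_closed.
  move=> si; have : (side i `&` side k) (p k) by split.
  rewrite sides // => -[[/p_inj ki|/= /p_inj ki] _].
    by rewrite ki eqxx in ik.
  by rewrite ki ordSK eqxx in ik'.
have [e e0 eP] : exists2 e : C, 0 < e & forall w, `|disk_val (g w)| < e ->
    forall i, i != k -> i != ord_pred k -> ~ side i w.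
  have : \forall u \near (0 : C), forall i, i != k -> i != ord_pred k ->
      ~ side i (g' (disk_of u)).
    have gc : {for (0 : C), continuous (g' \o @disk_of R)}.
      rewrite -gp; apply: continuous_comp; last exact: AutD_continuous.
      have := @disk_of_continuous R.
      rewrite continuous_open_subspace; last exact: udisk_set_open.
      by apply; rewrite inE; exact: disk_val_lt1.
    apply: (gc [set w | forall i, i != k -> i != ord_pred k -> ~ side i w]).
    by rewrite /= -gp disk_valK gK; exact: far_sides.
  move=> /nbhs_norm0P[e /= e0 eP]; exists e => // w we.
  by have := eP _ we; rewrite disk_valK gK.
have [w0 Fw0 w0e] : exists2 w0, interior F w0 & `|disk_val (g w0)| < e.
  have : closure (interior F) (p k).
    have : (F `\` interior F) (p k) by rewrite F_bd; exists k => //; exact: vertex_side.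
    by rewrite F_reg => -[].
  have gc : disk_val (g w) @[w --> p k] --> (0 : C).
    rewrite -gp; apply: continuous_comp; first exact: AutD_continuous.
    exact: disk_val_continuous.
  by move=> /(_ _ (cvgr0_norm_lt _ gc _ e0))[w0 [? ?]]; exists w0.
set rho := `|disk_val (g w0)| in w0e.
have rho0 : 0 < rho.
  rewrite normr_gt0; apply: contra_notN (side_bd k _ (vertex_side k)) => /eqP gw0.
  suff -> : p k = w0 by [].
  by apply/(can_inj gK)/(@disk_val_inj R); rewrite gp gw0.
have rho1 t : `|rho * circle t| = rho.
  by rewrite normrM norm_circle mulr1 ger0_norm // ltW.
pose arc t := g' (disk_of (rho * circle t)).
have arcE t : disk_val (g (arc t)) = rho * circle t.
  by rewrite g'K disk_ofK // rho1; exact: disk_val_lt1.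
have arc_cont : continuous arc.
  move=> t; apply: continuous_comp; last exact: AutD_continuous.
  apply: disk_continuous.
  rewrite (_ : _ \o _ = fun t : R => rho * circle t); last first.
    by apply/funext => s /=; rewrite disk_ofK // rho1; exact: disk_val_lt1.
  by apply: (@cvgMl_tmp C); exact: circle_continuous.
have ray_dir t (s : C) al : 0 <= s -> rho * circle t = s * (`|q| * circle al) ->
    circle t = circle al.
  move=> s0 h; have := congr1 Num.norm h.
  rewrite rho1 !normrM norm_circle mulr1 normr_id (ger0_norm s0) => rhoE.
  apply: (mulfI (lt0r_neq0 rho0)); rewrite h rhoE; ring.
have arc_off t : circle t != circle be -> circle t != circle (be + theta) ->
    forall i, ~ side i (arc t).
  move=> t1 t2 i; have [->|ik] := eqVneq i k.
    move=> /(geodesic_source gA gp)[s s0]; rewrite arcE -/q qE.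
    by move=> /(ray_dir _ _ _ s0) te; rewrite te eqxx in t1.
  have [->|ik'] := eqVneq i (ord_pred k).
    rewrite /side ord_predK => /(geodesic_target gA gp)[s s0].
    rewrite arcE corner qE [circle theta * _]mulrCA -circleD.
    by move=> /(ray_dir _ _ _ s0) te; rewrite te addrC eqxx in t2.
  by apply: eP => //; rewrite arcE rho1.
have [al al_itv arc_al] : exists2 al, be <= al < be + 2 * pi & arc al = w0.
  have [al' al'E] := circle_polar (disk_val (g w0)).
  have [al ? alE] := circle_mod be al'; exists al => //.
  by rewrite /arc alE -al'E disk_valK gK.
have arc_Fo : open (arc @^-1` interior F).
  by apply: open_comp (open_interior F) => t _; exact: arc_cont.
have [l [u [lu al_lu off]]] : exists l u, [/\ theta <= u - l, l <= al < u &
    forall t, l < t < u -> forall i, ~ side i (arc t)].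
  have off be' t : 0 < t - be' < 2 * pi -> circle t != circle be'.
    move=> /circle_neq1; apply: contra_neq => te.
    by rewrite circleD te -circleD subrr circle0.
  have off' be' t : 0 < be' - t < 2 * pi -> circle t != circle be'.
    by move=> h; rewrite eq_sym off.
  have [al_lt|al_ge] := ltP al (be + theta).
    exists be, (be + theta); split; [lra|lra|].
    move=> t tI; apply: arc_off; [apply: off|apply: off']; lra.
  exists (be + theta), (be + 2 * pi); split; [lra|lra|].
  move=> t tI; apply: arc_off; apply: off; lra.
have /nbhs_ballP[d /= d0 dP] : nbhs al (arc @^-1` interior F).
  by apply: open_nbhs_nbhs; split=> //=; rewrite arc_al.
pose al' := Num.min (al + d / 2) ((al + u) / 2).
have al'_d : al < al' <= al + d / 2 by rewrite /al' lt_min ge_min lexx /=; lra.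
have al'_u : al' < u by rewrite /al' gt_min; apply/orP; right; lra.
have Fal' : interior F (arc al').
  by apply: dP; rewrite /ball /= ler0_norm; lra.
have in_F t : l < t < u -> interior F (arc t).
  have : connected `]l, u[%classic by apply/connected_intervalP/interval_is_interval.
  move=> /(_ (`]l, u[%classic `&` arc @^-1` interior F)) => hc tI.
  suff : (`]l, u[%classic `&` arc @^-1` interior F) t by case.
  rewrite hc.
  - by rewrite /= in_itv.
  - by exists al'; split => //; rewrite /= in_itv /=; lra.
  - by exists (arc @^-1` interior F).
  exists (arc @^-1` F).
    apply: closed_comp => [s _|]; first exact: arc_cont.
    by apply: compact_closed F_cpt; exact: udisk_hausdorff.
  apply/seteqP; split=> s [sI /= Fs]; split=> //.
    exact: interior_subset Fs.
  apply: contrapT => nFs.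
  have [i _ sis] : (\bigcup_i side i) (arc s) by rewrite -F_bd; split.
  by move: sis; apply: off; move: sI; rewrite /= in_itv.
pose t1 := (l + u - phi) / 2.
have y_arc t : y (arc t) = arc (phi + t).
  by apply/(can_inj gK)/(@disk_val_inj R); rewrite y_rot !arcE circleD; ring.
have [y1|yn1] := pselect (y = id).
  have := y_arc 0; rewrite y1 => /(congr1 (@disk_val R \o g)) /=.
  rewrite !arcE addr0 circle0 => /(mulfI (lt0r_neq0 rho0)) /esym /eqP.
  by apply/negP; apply: circle_neq1; lra.
have : ((y @` interior F) `&` interior F) (arc (phi + t1)).
  split; last by apply: in_F; rewrite /t1; lra.
  by exists (arc t1); [apply: in_F; rewrite /t1; lra|exact: y_arc].
by rewrite Fdisj.
Qed.

End Corner.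

(** * The stabilizer of a vertex of the canonical polygon *)

Section Stabilizer.
Variable R : realType.
Local Notation C := (Cplx R).
Local Notation D := (udisk R).

Lemma minimal_rotation_coordinate m (x : D -> D) :
  positive_minimal_rotation m x -> exists g g', [/\ AutD g, cancel g g',
    cancel g' g & rotates g (2 * pi / m%:R) x].
Proof.
move=> [g [g' [gA g'A gK g'K gx]]]; exists g, g'; split=> // w.
by rewrite -{1}(gK w) gx.
Qed.

Lemma rotates_fixed g (t : R) x z : rotates g t x -> circle t != 1 -> x z = z ->
  disk_val (g z) = 0.
Proof.
move=> /(_ z) + t1 xz; rewrite xz => /eqP.
rewrite eq_sym -subr_eq0 -[X in _ - X]mul1r -mulrBl mulf_eq0 subr_eq0 (negPf t1).
by move=> /eqP.
Qed.

(** Modulo powers of x_j, whose angles are the multiples of 2 pi / m_j, an element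
    of the stabilizer turns by an angle in [0, 2 pi / m_j[, and then
    [no_small_rotation] leaves the angle 0 only. *)
Lemma stab_canonical_generator (Gamma : set (D -> D)) r (m : 'I_r -> nat)
    (x : 'I_r -> (D -> D)) j z y :
  subgroup Gamma (@AutD R) -> canonical_generators Gamma m x -> (1 < m j)%N ->
  x j z = z -> Gamma y -> y z = z -> exists i, y = iter i (x j).
Proof.
move=> [Ggrp GA] [[Ggen _ _ _] [p [F [poly fund pairing]]] min_rot] m1 xz Gy yz.
have Gx : Gamma (x j) by rewrite -Ggen; apply: generated_sub; exists j.
have [g [g' [gA gK g'K x_rot]]] := minimal_rotation_coordinate (min_rot j).
set theta : R := 2 * pi / (m j)%:R in x_rot.
have mR : 0 < (m j)%:R :> R by rewrite ltr0n ltnW.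
have pi0 := pi_gt0 R.
have theta0 : 0 < theta by rewrite divr_gt0 // mulr_gt0.
have theta_pi : theta <= pi.
  by rewrite ler_pdivrMr // mulrC ler_pM2l // ler_nat.
have thetaM : theta * (m j)%:R = 2 * pi by rewrite divfK // gt_eqF.
have theta1 : circle theta != 1 by apply: circle_neq1; lra.
have gz := rotates_fixed x_rot theta1 xz.
have kP : (j.*2.+1 < r.*2)%N by rewrite ltn_Sdouble.
have [xp xpS] := pairing j (Ordinal kP) erefl; set k := Ordinal kP in xp xpS.
have gp := rotates_fixed x_rot theta1 xp.
have [phi0 phi0E] := stab_rotates gA gK g'K gz (GA _ Gy) yz.
have [phi /andP[phi_ge0 phi_lt] phiE] := circle_mod 0 phi0.
have y_rot : rotates g phi y by move=> w; rewrite phiE.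
pose i := Num.trunc (phi / theta).
have /andP[i_le i_gt] : i%:R <= phi / theta < i.+1%:R.
  by apply: truncn_itv; rewrite divr_ge0 // ltW.
rewrite ler_pdivlMr // mulrC in i_le; rewrite ltr_pdivrMr // mulrC in i_gt.
exists i; pose psi := phi - theta * i%:R.
have psi0 : 0 <= psi by rewrite /psi; lra.
have psi_lt : psi < theta by move: i_gt; rewrite /psi -natr1; lra.
have [psi_eq0|psi_neq0] := eqVneq psi 0.
  apply: (rotates_inj (can_inj gK) y_rot).
  suff -> : phi = theta *+ i by exact: rotates_iter.
  by move: psi_eq0; rewrite /psi -mulr_natr; lra.
(* x_j has order m_j, so x_j^(i (m_j - 1)) is the inverse of x_j^i *)
have rot' : rotates g psi (y \o iter (i * (m j).-1) (x j)).
  move=> w; rewrite (rotates_comp y_rot (rotates_iter _ x_rot)).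
  suff -> : phi + theta *+ (i * (m j).-1) = psi + 2 * pi * i%:~R.
    by rewrite circleD circle_2piz mulr1.
  rewrite /psi -[_ *+ (i * _)]mulr_natr natrM -subn1 natrB 1?ltnW //.
  by rewrite -thetaM -pmulrn; ring.
have theta_itv : 0 < theta <= pi by rewrite theta0.
have corner : disk_val (g (p (ord_pred k))) =
    circle theta * disk_val (g (p (ordS k))) by rewrite -xpS x_rot.
have Gy' : Gamma (y \o iter (i * (m j).-1) (x j)).
  by have [_ GM _] := Ggrp; apply: GM => //; exact: group_iter.
have psi_itv : 0 < psi < theta by rewrite lt0r psi_neq0 psi0.
by have := no_small_rotation poly fund gA gK g'K gp theta_itv corner Gy' rot' psi_itv.
Qed.

End Stabilizer.

(** * Discrete groups acting freely at a point *)

Section Wandering.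
Variable R : realType.
Local Notation C := (Cplx R).
Local Notation D := (udisk R).

(** Heine-Borel, transported from a square in R x R. *)
Lemma bounded_sub_compact (M : C) : 0 <= M ->
  exists2 B : set C, compact B & forall c : C, `|c| <= M -> B c.
Proof.
move=> M0; pose M' := complex.Re M.
have ME : M = (M'%:C)%C by apply/esym/RRe_real; rewrite ger0_real.
exists ((fun p : R * R => (p.1 +i* p.2)%C : C) @`
    (`[- M', M']%classic `*` `[- M', M']%classic)).
  apply: continuous_compact; last by apply: compact_setX; exact: segment_compact.
  by apply: continuous_subspaceT => p; exact: complex_continuous.
have bnd (t u : R) : ((Num.sqrt (t ^+ 2 + u ^+ 2))%:C)%C <= M -> - M' <= t <= M'.
  rewrite -ler_norml -lecR -ME; apply: le_trans.
  by rewrite lecR -sqrtr_sqr ler_sqrt ?lerDl ?addr_ge0 ?sqr_ge0.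
move=> [a b]; rewrite normc_def /= => abM; exists (a, b) => //.
split; rewrite /= in_itv /=; first exact: bnd abM.
by apply: (bnd b a); rewrite addrC.
Qed.

(** A Moebius self-map that does not push some point far towards the boundary has
    bounded coefficients: 1 - |k w|^2 = (1 - |w|^2) / |b^* w + a^*|^2, where
    |b^* w + a^*| >= |a| (1 - |w|). *)
Lemma moebius_coef_bound (a b : C) (k : D -> D) (rho : C) w :
  moebius a b k -> 0 <= rho -> rho < 1 ->
  `|disk_val w| <= rho -> `|disk_val (k w)| <= rho ->
  `|a| <= ((1 - rho) ^+ 2 * (1 - rho ^+ 2))^-1.
Proof.
move=> [ab kE] r0 r1 wr kwr.
set c := _ * _.
have s1 : 0 < 1 - rho by rewrite subr_gt0.
have s2 : 0 < 1 - rho ^+ 2 by rewrite subr_gt0 expr_lt1.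
have c0 : 0 < c by rewrite mulr_gt0 // exprn_gt0.
have n := moebius_den_neq0 ab (disk_val_lt1 w).
set W := disk_val w in wr n; set d := b^* * W + a^* in n.
have dE : `|d| ^+ 2 * (1 - `|disk_val (k w)| ^+ 2) = 1 - `|W| ^+ 2.
  rewrite kE -/W -/d normrM normfV expr_div_n mulrBr mulr1 mulrCA.
  rewrite divff ?mulr1; last by rewrite expf_neq0 // normr_eq0.
  rewrite !normCK /d !rmorphD !rmorphM /= !conjCK -[RHS]mul1r -{1}ab; ring.
have a2 := norm_moebius_coef ab.
have ba : `|b| <= `|a| by rewrite -(@ler_pXn2r _ 2) ?nnegrE // a2 lerDr.
have a1 : 1 <= `|a| by rewrite -(@expr_ge1 _ 2) // a2 lerDl exprn_ge0.
have ad : `|a| * (1 - rho) <= `|d|.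
  rewrite mulrBr mulr1 lerBlDr.
  have -> : `|a| = `|d - b^* * W| by rewrite /d addrC addKr norm_conjC.
  apply: le_trans (ler_normB _ _) _; rewrite lerD2l normrM norm_conjC.
  rewrite /d addrC addKr norm_conjC.
  by apply: ler_pM => //; rewrite normr_ge0.
have ac : `|a| * c <= 1.
  apply: (@le_trans _ _ (`|d| ^+ 2 * (1 - `|disk_val (k w)| ^+ 2))); last first.
    by rewrite dE gerBl exprn_ge0.
  apply: (@le_trans _ _ ((`|a| * (1 - rho)) ^+ 2 * (1 - rho ^+ 2))).
    have -> : (`|a| * (1 - rho)) ^+ 2 * (1 - rho ^+ 2) = `|a| ^+ 2 * c by rewrite /c; ring.
    by apply: ler_wpM2r; [exact: ltW|exact: ler_eXnr].
  have p0 : 0 <= `|a| * (1 - rho) by rewrite mulr_ge0 // ltW.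
  apply: ler_pM; [exact: exprn_ge0|exact: ltW| |].
    by rewrite ler_pXn2r // nnegrE.
  by rewrite lerD2l lerN2 ler_pXn2r // nnegrE.
by rewrite -[leRHS]mul1r ler_pdivlMr.
Qed.

(** Two elements of a discrete group with close matrices are equal, since the
    quotient of one by the other is close to the identity. *)
Lemma moebius_near_eq (G : set (D -> D)) (e : C) (a b a1 b1 eta L : C) k k1 :
  is_group G ->
  (forall a b g, G g -> moebius a b g -> `|a - 1| < e -> `|b| < e -> g = id) ->
  G k -> G k1 -> moebius a b k -> moebius a1 b1 k1 ->
  `|a - a1| <= eta -> `|b - b1| <= eta -> `|a1| + `|b1| <= L -> eta * L < e ->
  k = k1.
Proof.
move=> [_ GM GV] discr Gk Gk1 km k1m ha hb hL small.
have [h [Gh hk kh]] := GV _ Gk1.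
have hK : cancel h k1 by move=> w; exact: (congr1 (@^~ w) kh).
have hm := moebius_comp (moebius_can k1m hK) km.
have eta0 : 0 <= eta by apply: le_trans ha.
have bound (u v : C) : `|u| <= eta -> `|v| <= eta -> `|a1| * `|u| + `|b1| * `|v| < e.
  move=> ue ve; apply: le_lt_trans small; apply: le_trans (ler_wpM2l eta0 hL).
  by rewrite mulrDr ![eta * _]mulrC lerD // ler_wpM2l.
have k_id : h \o k = id.
  apply: (discr _ _ _ _ hm); first exact: GM.
    have -> : a1^* * a + - b1 * b^* - 1 = a1^* * (a - a1) - b1 * (b - b1)^*.
      by case: k1m => <- _; rewrite rmorphB /=; ring.
    apply: le_lt_trans (ler_normB _ _) _; rewrite !normrM !norm_conjC; exact: bound.
  have -> : a1^* * b + - b1 * a^* = a1^* * (b - b1) - b1 * (a - a1)^*.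
    by rewrite rmorphB /=; ring.
  apply: le_lt_trans (ler_normB _ _) _; rewrite !normrM !norm_conjC; exact: bound.
by apply/funext => w; rewrite -[LHS]hK -[h (k w)]/((h \o k) w) k_id.
Qed.

(** The elements of G that map some point near z to a point near z have their
    coefficients in a compact set.  By discreteness, each pair of coefficients
    has a neighbourhood that contains those of at most one element k <> id of G,
    and this k separates the points near z from their images since k z <> z.
    Compactness makes the neighbourhood of z uniform. *)
Lemma wandering_nbhs (G : set (D -> D)) (z : D) :
  subgroup G (@AutD R) -> discrete_in_AutD G ->
  (forall k, G k -> k z = z -> k = id) ->
  exists U : set D, [/\ open U, U z &
    forall k w, G k -> U w -> U (k w) -> k = id].
Proof.
move=> [Ggrp GA] [e e0 discr] free.
pose rho : C := (1 + `|disk_val z|) / 2.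
have z1 := disk_val_lt1 z.
have rho0 : 0 <= rho by rewrite divr_ge0 // addr_ge0.
have rho1 : rho < 1.
  by rewrite ltr_pdivrMr // mul1r (_ : 2 = 1 + 1) // ltrD2l.
have z_rho : `|disk_val z| < rho by rewrite ltr_pdivlMr // mulr_natr mulr2n ltrD2r.
pose M := ((1 - rho) ^+ 2 * (1 - rho ^+ 2))^-1.
have M0 : 0 <= M.
  rewrite invr_ge0 mulr_ge0 ?exprn_ge0 // subr_ge0 ?ltW //.
  by rewrite exprn_ilte1.
have [B B_cpt BP] := bounded_sub_compact M0.
pose sep (w : D * D) (ab : C * C) := forall k, G k -> moebius ab.1 ab.2 k ->
  k w.1 = w.2 -> k = id.
have sep_near : \forall w \near (z, z), B `*` B `<=` sep w.
  have /compact_near_coveringP cov := compact_setX B_cpt B_cpt.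
  apply: (cov _ (nbhs (z, z)) sep) => -[a0 b0] _.
  pose L := `|a0| + `|b0| + 1.
  have L0 : 0 < L by rewrite ltr_wpDl // addr_ge0.
  have Le0 : 0 < L + e by rewrite addr_gt0.
  pose eta := e / (L + e).
  have eta0 : 0 < eta by rewrite divr_gt0.
  have eta20 : 0 < eta / 2 by rewrite divr_gt0.
  have eta1 : eta <= 1 by rewrite ler_pdivrMr // mul1r lerDr ltW.
  have eta_e : eta * L < e.
    by rewrite mulrAC ltr_pdivrMr // ltr_pM2l // ltrDl.
  pose close (ab : C * C) := `|ab.1 - a0| < eta / 2 /\ `|ab.2 - b0| < eta / 2.
  have nbhs_ball_c (c : C) : nbhs c (ball c (eta / 2)) by exact: nbhsx_ballx.
  have close_near : nbhs (a0, b0) close.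
    exists (ball a0 (eta / 2), ball b0 (eta / 2)) => /=.
      by split; exact: nbhs_ball_c.
    by move=> [a b] /=; rewrite -!ball_normE /= ![`|_ - a|]distrC ![`|_ - b|]distrC.
  have close2 (u v c : C) : `|u - c| < eta / 2 -> `|v - c| < eta / 2 -> `|u - v| <= eta.
    move=> uc vc; rewrite (_ : u - v = (u - c) - (v - c)); last by ring.
    apply: le_trans (ler_normB _ _) _; rewrite [eta]splitr.
    by apply: lerD; exact: ltW.
  have close_norm (u c : C) : `|u - c| < eta / 2 -> `|u| <= `|c| + eta / 2.
    move=> uc; rewrite -lerBlDl; apply: le_trans (ltW uc); exact: lerB_dist.
  have uniq_k k k1 a b a1 b1 : G k -> G k1 -> moebius a b k -> moebius a1 b1 k1 ->
      close (a, b) -> close (a1, b1) -> k = k1.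
    move=> Gk Gk1 km k1m [/= ha hb] [/= ha1 hb1].
    apply: (moebius_near_eq Ggrp discr Gk Gk1 km k1m (close2 _ _ _ ha ha1)
      (close2 _ _ _ hb hb1) _ eta_e).
    apply: le_trans (lerD (close_norm _ _ ha1) (close_norm _ _ hb1)) _.
    by rewrite addrACA -splitr lerD2l.
  have [[k1 [a1 [b1 [Gk1 k1_id k1m c1]]]]|none] := pselect (exists k a b,
      [/\ G k, k <> id, moebius a b k & close (a, b)]); last first.
    exists (close, setT) => /=; first by split => //; exact: filterT.
    move=> [[a b] w] [/= cab _] k Gk km _; apply: contrapT => k_id.
    by apply: none; exists k, a, b.
  have k1z : k1 z != z by apply/eqP => /(free _ Gk1).
  have := @udisk_hausdorff R; rewrite open_hausdorff => /(_ _ _ k1z).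
  move=> [[A1 A2] /= [kz_A1 z_A2] [A1o A2o A12]].
  rewrite !inE in kz_A1 z_A2.
  exists (close, (k1 @^-1` A1) `*` A2) => /=.
    split => //; exists (k1 @^-1` A1, A2) => //=; split.
      by apply: (AutD_continuous (GA _ Gk1)); exact: open_nbhs_nbhs.
    exact: (@open_nbhs_nbhs D z A2 (conj A2o z_A2)).
  move=> [[a b] [w w']] [/= cab [/= kw A2w]] k Gk km /= kww.
  have kk1 := uniq_k _ _ _ _ _ _ Gk Gk1 km k1m cab c1.
  have : (A1 `&` A2) w' by split=> //; rewrite -kww kk1.
  by rewrite (eqP A12).
have z_near : \forall w \near z, `|disk_val w| < rho.
  exact: (cvgr_norm_lt _ (@disk_val_continuous R z) _ z_rho).
case: sep_near => -[U1 U2] /= [zU1 zU2] U12.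
pose V := U1 `&` U2 `&` [set w | `|disk_val w| < rho].
have zV : nbhs z V by apply: filterI => //; exact: filterI.
exists (interior V); split=> [| |k w Gk]; first exact: open_interior.
  exact: zV.
move=> /interior_subset[[U1w _] /= wr] /interior_subset[[_ U2kw] /= kwr].
have [a [b km]] := GA _ Gk.
have aM := moebius_coef_bound km rho0 rho1 (ltW wr) (ltW kwr).
have bM : `|b| <= M.
  apply: le_trans aM; rewrite -(@ler_pXn2r _ 2) ?nnegrE //.
  by rewrite (norm_moebius_coef (proj1 km)) lerDr.
by apply: (U12 (w, k w) _ (a, b)) => //; split; exact: BP.
Qed.

End Wandering.

(** * Derivatives in charts and quotient maps *)

Section ComplexDerivative.
Variable R : realType.
Local Notation C := (Cplx R).
Implicit Types f g : C -> C.

Lemma is_derive_chain f g (x a b : C) :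
  is_derive x (1 : C) f a -> is_derive (f x) (1 : C) g b ->
  is_derive x (1 : C) (g \o f) (b * a).
Proof.
move=> [fd fa] [gd gb].
have /derivable1_diffP fD := fd; have /derivable1_diffP gD := gd.
have gfD := differentiable_comp fD gD.
have f'E : 'd f x (1 : C) = a by apply: etrans fa; exact: esym (deriveE (1 : C) fD).
apply: DeriveDef; first exact/derivable1_diffP.
apply: (etrans (deriveE (1 : C) gfD)).
apply: (etrans (congr1 (fun h => h (1 : C)) (diff_comp fD gD))).
apply: (etrans (congr1 (fun h => h ('d f x (1 : C))) (deriv1E gd))).
apply: (etrans (congr1 (fun u : C => u *: (derive1 g (f x) : C)) f'E)).
apply: (etrans (congr1 (fun u : C => a *: u) (etrans (derive1E _ _) gb))).
exact: mulrC.
Qed.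

Lemma is_derive_shift (x t : C) : is_derive x (1 : C) (fun u : C => u + t) 1.
Proof.
apply: DeriveDef; first by apply: derivableD; [exact: derivable_id|exact: derivable_cst].
by rewrite deriveD ?derive_id ?derive_cst ?addr0.
Qed.

End ComplexDerivative.

Section DerivativeInCharts.
Variable R : realType.
Local Notation C := (Cplx R).

(** The derivative of F at x, with the continuity that makes chains of charts
    compose. *)
Definition deriv_at (X Y : topologicalType) (c : chart R X) (d : chart R Y)
    (F : X -> Y) (x : X) (a : C) : Prop :=
  [/\ cdom c x, cdom d (F x), {for x, continuous F} &
      is_derive (cmap c x) (1 : C) (cmap d \o F \o cinv c) a].

Implicit Types X Y Z : topologicalType.

Lemma chart_inv_cvg X (c : chart R X) x : is_chart c -> cdom c x ->
  cinv c v @[v --> cmap c x] --> x.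
Proof.
move=> [_ imo cK _ ic] cx; rewrite -{2}(cK _ cx).
move: ic; rewrite continuous_open_subspace //; apply.
by rewrite inE; exists x.
Qed.

Lemma near_chart X (c : chart R X) x (A : set X) : is_chart c -> cdom c x ->
  (\forall y \near x, A y) -> \forall v \near cmap c x, A (cinv c v).
Proof. by move=> cc cx xA; exact: (chart_inv_cvg cc cx). Qed.

Lemma near_cdom X (c : chart R X) x : is_chart c -> cdom c x ->
  \forall y \near x, cdom c y.
Proof. by move=> [co _ _ _ _] cx; exact: open_nbhs_nbhs. Qed.

Lemma deriv_at_near X Y (c : chart R X) (d : chart R Y) (F G : X -> Y) x a :
  is_chart c -> (\forall y \near x, F y = G y) ->
  deriv_at c d F x a -> deriv_at c d G x a.
Proof.
move=> cc FG [cx dFx Fc Fd]; have FGx := nbhs_singleton FG; split=> //.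
- by rewrite -FGx.
- have Gc : G y @[y --> x] --> F x.
    apply: cvg_trans Fc; apply: near_eq_cvg.
    by apply: filterS FG => y ->.
  by move: Gc; rewrite FGx.
apply: (near_eq_is_derive _ Fd).
by have := near_chart cc cx FG; apply: filterS => v /= ->.
Qed.

Lemma deriv_at_comp X Y Z (c : chart R X) (d : chart R Y) (e : chart R Z)
    (F : X -> Y) (G : Y -> Z) x a b :
  is_chart c -> is_chart d ->
  deriv_at c d F x a -> deriv_at d e G (F x) b ->
  deriv_at c e (G \o F) x (b * a).
Proof.
move=> cc cd [cx dFx Fc Fd] [_ eGFx Gc Gd]; split => //.
  exact: continuous_comp.
have cK : cinv c (cmap c x) = x by case: cc => _ _ cK _ _; exact: cK.
have dK y : cdom d y -> cinv d (cmap d y) = y by case: cd => _ _ dK _ _; exact: dK.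
have Gd' : is_derive ((cmap d \o F \o cinv c) (cmap c x)) (1 : C)
    (cmap e \o G \o cinv d) b by rewrite /= cK.
apply: (near_eq_is_derive _ (is_derive_chain Fd Gd')).
have := near_chart cc cx (Fc _ (near_cdom cd dFx)).
by apply: filterS => v /= dv; rewrite dK.
Qed.

Lemma deriv_at_uniq X Y (c : chart R X) (d : chart R Y) (F : X -> Y) x a b :
  deriv_at c d F x a -> deriv_at c d F x b -> a = b.
Proof. by move=> [_ _ _ [_ <-]] [_ _ _ [_ <-]]. Qed.

Lemma deriv_at_id X (c : chart R X) x : is_chart c -> cdom c x ->
  deriv_at c c id x 1.
Proof.
move=> cc cx; split => //.
apply: (near_eq_is_derive _ (is_derive_id _ _)).
case: cc => _ imo cK _ _.
have : \forall v \near cmap c x, (cmap c @` cdom c) v.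
  by apply: (@open_nbhs_nbhs _ _ (cmap c @` cdom c)); split=> //; exists x.
by apply: filterS => _ /= [y cy <-]; rewrite cK.
Qed.

Lemma deriv_at_transition X (c d : chart R X) x : compatible c d ->
  cdom c x -> cdom d x -> exists a, deriv_at c d id x a.
Proof.
move=> cd cx dx; have dv : derivable (cmap d \o cinv c) (cmap c x) (1 : C).
  by apply: cd; exists x.
by eexists; split=> //; exact/derivableP.
Qed.

Lemma deriv_at_holo (X Y : riemannSurface R) (F : X -> Y) c d x :
  holo_map F -> rs_atlas c -> rs_atlas d -> cdom c x -> cdom d (F x) ->
  exists a, deriv_at c d F x a.
Proof.
move=> [Fc Fh] ca da cx dFx.
have dv : derivable (cmap d \o F \o cinv c) (cmap c x) (1 : C).
  by apply: (Fh c d) => //; exists x.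
by eexists; split=> //; exact: Fc.
Qed.

End DerivativeInCharts.

Section Quotients.
Variable R : realType.
Local Notation C := (Cplx R).
Variables (X Q : riemannSurface R) (H : set (X -> X)) (p : X -> Q).
Hypothesis quo : is_quotient H p.

Lemma quotient_continuous : continuous p.
Proof. by apply/continuousP => A; case: quo => _ _ /(_ A)[]. Qed.

Lemma quotient_open (U : set X) : (forall h, H h -> continuous h) ->
  open U -> open (p @` U).
Proof.
move=> Hc Uo; case: quo => _ orb /(_ (p @` U))[_ pU] _; apply: pU.
have -> : p @^-1` (p @` U) = \bigcup_(h in H) (h @^-1` U).
  apply/seteqP; split=> w /=.
    by move=> [w' Uw' /esym/orb[h Hh hw]]; exists h => //=; rewrite hw.
  by move=> [h Hh /= Uhw]; exists (h w) => //; apply/esym/orb; exists h.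
apply: bigcup_open => h Hh; apply: open_comp => // w _; exact: Hc.
Qed.

(** A chart of Q is a holomorphic function on its domain, hence so is its
    pull-back. *)
Lemma deriv_at_quotient c d x :
  rs_atlas c -> rs_atlas d -> cdom c x -> cdom d (p x) ->
  exists a, deriv_at c d p x a.
Proof.
move=> ca da cx dpx; have domO : open (cdom d) by case: (rs_charts da).
have dv : derivable (cmap d \o p \o cinv c) (cmap c x) (1 : C).
  case: quo => _ _ _ /(_ _ (cmap d) domO)[holo _].
  apply: (holo _ c ca); last by exists x.
  by move=> e ea; exact: rs_compatible.
by eexists; split=> //; exact: quotient_continuous.
Qed.

(** The section inverts p on U, and U and p(U) are open.  It is holomorphic by the
    description of the holomorphic functions on a quotient: on the preimage of
    p(U) the map sg o p agrees locally with some element of H. *)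
Lemma quotient_local_section (U : set X) (z : X) :
  (forall h, H h -> holo_map h) -> open U -> U z ->
  (forall h w, H h -> U w -> U (h w) -> h = id) ->
  exists sg : Q -> X, (forall w, U w -> sg (p w) = w) /\
    forall c d, rs_atlas c -> rs_atlas d -> cdom c (p z) -> cdom d z ->
      exists a, deriv_at c d sg (p z) a.
Proof.
move=> Hh Uo Uz free; have Hc h : H h -> continuous h by move=> /Hh[].
have [_ orb _ quo_holo] := quo.
pose sg q := xget z [set w | U w /\ p w = q].
have sgE w : U w -> sg (p w) = w.
  move=> Uw; have [Uv pv] : U (sg (p w)) /\ p (sg (p w)) = p w.
    by apply: (@xgetPex _ z [set v | U v /\ p v = p w]); exists w.
  have [h hH hv] := (orb _ _).1 pv.
  have h_id : h = id by apply: (free h (sg (p w))) => //; rewrite hv.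
  by rewrite h_id in hv.
exists sg; split=> // c d ca da cpz dz.
have domO : open (cdom d) by case: (rs_charts da).
pose W := U `&` cdom d; have Wo : open W by exact: openI.
have pWo := quotient_open Hc Wo.
have dv : derivable (cmap d \o sg \o cinv c) (cmap c (p z)) (1 : C).
  apply: ((quo_holo _ (cmap d \o sg) pWo).2 _ c ca); last first.
    by exists (p z) => //; split=> //; exists z.
  move=> e ea _ [w [ew [w' [Uw' dw'] /esym/orb[h Hhh hw]]] <-].
  rewrite -hw in Uw' dw'.
  have [a hd] := deriv_at_holo (Hh _ Hhh) ea da ew dw'.
  suff [_ _ _ [] //] : deriv_at e d (sg \o p) w a.
  apply: deriv_at_near hd; first exact: rs_charts.
  have : \forall v \near w, U (h v) by apply: (Hc _ Hhh); exact: open_nbhs_nbhs.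
  apply: filterS => v Uhv /=; rewrite -[LHS]sgE //; congr (sg _).
  by apply/esym/orb; exists h.
eexists; split; [exact: cpz| |  |exact/derivableP].
  by rewrite sgE.
move=> A; rewrite sgE // => zA.
have : nbhs (p z) (p @` (U `&` interior A)).
  apply: open_nbhs_nbhs; split; last by exists z.
  by apply: quotient_open => //; apply: openI => //; exact: open_interior.
by apply: filterS => _ [w [Uw Aw] <-] /=; rewrite sgE //; exact: interior_subset.
Qed.

End Quotients.

(** * The linear coefficient at a fixed point *)

Section Delta.
Variable R : realType.
Local Notation C := (Cplx R).
Implicit Types X S : riemannSurface R.

Definition translate_chart (X : Type) (c : chart R X) (t : C) : chart R X :=
  Chart (cdom c) (fun x => cmap c x + - t) (fun v => cinv c (v + t)).

Lemma shift_continuous (t : C) : continuous (fun u : C => u + t).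
Proof.
move=> u; apply/differentiable_continuous/derivable1_diffP.
by have [] := is_derive_shift u t.
Qed.

Lemma derivable_chain (f g : C -> C) (v : C) :
  derivable f v 1 -> derivable g (f v) 1 -> derivable (g \o f) v 1.
Proof.
by move=> /derivableP df /derivableP dg; have [] := is_derive_chain df dg.
Qed.

Lemma translate_chart_image (X : Type) (c : chart R X) t (A : set X) :
  cmap (translate_chart c t) @` A = (fun u : C => u + t) @^-1` (cmap c @` A).
Proof.
apply/seteqP; split=> v /=.
  by move=> [x Ax <-]; exists x => //; rewrite subrK.
by move=> [x Ax xv]; exists x => //; rewrite xv addrK.
Qed.

Lemma translate_is_chart (X : topologicalType) (c : chart R X) t :
  is_chart c -> is_chart (translate_chart c t).
Proof.
move=> [co imo cK mc ic]; have im'o : open (cmap (translate_chart c t) @` cdom c).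
  rewrite translate_chart_image; apply: open_comp imo => u _.
  exact: (@shift_continuous t u).
split; first exact: co.
- exact: im'o.
- by move=> x cx /=; rewrite subrK cK.
- move=> x; apply: (@continuous_comp (subspace (cdom c)) C C (cmap c)
    (fun u : C => u + - t) x (mc x)).
  exact: (@shift_continuous (- t) (cmap c x)).
apply: continuous_in_subspaceT => v vim.
apply: (@continuous_comp C C X (fun u : C => u + t) (cinv c) v).
  exact: (@shift_continuous t v).
have ic' : {in cmap c @` cdom c, continuous (cinv c)}.
  by move: ic; rewrite continuous_open_subspace.
by apply: ic'; move: vim; rewrite !inE => -[x cx <-]; exists x => //=; rewrite subrK.
Qed.

(** An atlas chart around x, translated so that x goes to 0; [delta] quantifies
    over the centered charts, so its value is meaningful only if there is one. *)
Lemma centered_chart_exists X (x : X) : exists c, centered_chart x c.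
Proof.
have [e ea ex] := rs_cover x.
exists (translate_chart e (cmap e x)); split; [|exact: ex|exact: subrr].
split; first exact/translate_is_chart/rs_charts.
move=> d da; split=> v.
  rewrite translate_chart_image /= => v_im.
  apply: (@derivable_chain (fun u => u + cmap e x) (cmap d \o cinv e)).
    by have [] := is_derive_shift v (cmap e x).
  exact: (rs_compatible ea da).
move=> v_im; apply: (@derivable_chain (cmap e \o cinv d) (fun u => u + - cmap e x)).
  exact: (rs_compatible da ea).
by have [] := is_derive_shift ((cmap e \o cinv d) v) (- cmap e x).
Qed.

Lemma delta_eq X (x : X) (s : X -> X) a :
  (forall c, centered_chart x c -> deriv_at c c s x a) -> delta x s = a.
Proof.
move=> sa; have der c : centered_chart x c ->
    is_derive (0 : C) (1 : C) (cmap c \o s \o cinv c) a.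
  by move=> cc; have [_ _ <-] := cc; case: (sa c cc).
have [c cc] := centered_chart_exists x.
have := @getPex _ [set b : C | forall c, centered_chart x c ->
  is_derive (0 : C) (1 : C) (cmap c \o s \o cinv c) b] (ex_intro _ a der).
by move=> /(_ c cc)[_ delta_val]; case: (der c cc) => _ <-; exact: esym delta_val.
Qed.

(** In charts, s = F o y o L and id = F o L near F z.  By the chain rule the
    second equation says that the factors contributed by F, L and the changes of
    charts have product 1, and the first that the derivative of s is lam times
    this product. *)
Lemma delta_semiconj X S (F : X -> S) (L : S -> X) (y : X -> X) (s : S -> S)
    (z : X) cX dS a b lam :
  rs_atlas cX -> rs_atlas dS -> deriv_at cX dS F z a ->
  deriv_at dS cX L (F z) b -> L (F z) = z ->
  deriv_at cX cX y z lam -> y z = z ->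
  (\forall w \near F z, F (L w) = w) ->
  (\forall w \near F z, F (y (L w)) = s w) ->
  delta (F z) s = lam.
Proof.
move=> ca da Fa Lb LF yl yz FL FyL; apply: delta_eq => c [[cc adm] cF _].
have cX_chart := rs_charts ca; have dS_chart := rs_charts da.
have dF : cdom dS (F z) by case: Lb.
have [cd dc] := adm _ da.
have [u cdu] := deriv_at_transition cd cF dF.
have [v dcv] := deriv_at_transition dc dF cF.
have Lc := deriv_at_comp cc dS_chart cdu Lb.
have read (h : X -> X) (al : C) : h z = z -> deriv_at cX cX h z al ->
    deriv_at c c (F \o h \o L) (F z) (v * (a * (al * (b * u)))).
  move=> hz hal; have hal' : deriv_at cX cX h (L (F z)) al by rewrite LF.
  have hL := deriv_at_comp cc cX_chart Lc hal'.
  have Fa' : deriv_at cX dS F (h (L (F z))) a by rewrite LF hz.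
  have FhL := deriv_at_comp cc cX_chart hL Fa'.
  have dcv' : deriv_at dS c id (F (h (L (F z)))) v by rewrite LF hz.
  exact: deriv_at_comp cc dS_chart FhL dcv'.
have Fz_cX : cdom cX z by case: Fa.
have id1 := read id 1 erefl (deriv_at_id cX_chart Fz_cX).
have e1 : v * (a * (1 * (b * u))) = 1.
  apply: deriv_at_uniq (deriv_at_id cc cF).
  exact: deriv_at_near cc FL id1.
have -> : lam = v * (a * (lam * (b * u))).
  by rewrite -[LHS]mulr1 -e1; ring.
exact: deriv_at_near cc FyL (read y lam yz yl).
Qed.

End Delta.

Section DiskDerivative.
Variable R : realType.
Local Notation C := (Cplx R).
Local Notation D := (udisk R).

Lemma disk_atlas : @rs_atlas R (Disk R) (@disk_chart R).
Proof. by []. Qed.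

Lemma AutD_holo (g : D -> D) : AutD g -> holo_map (g : Disk R -> Disk R).
Proof.
move=> gA; split; first exact: AutD_continuous.
move=> c d -> -> v [w _ <-] /=; case: gA => [al [be [ab gE]]].
have := @moebius_fun_derivable R al be _ _ _ (moebius_den_neq0 ab (disk_val_lt1 w)).
apply: near_eq_derivable.
have : \forall u \near disk_val w, udisk_set u.
  by apply: open_nbhs_nbhs; split; [exact: udisk_set_open|exact: disk_val_lt1].
by apply: filterS => u u1 /=; rewrite gE disk_ofK.
Qed.

(** From g o y = e^(i t) g one gets g'(z) y'(z) = e^(i t) g'(z), and g'(z) is
    nonzero as g has a differentiable inverse. *)
Lemma deriv_at_rotates g g' (t : R) (y : D -> D) (z : Disk R) :
  AutD g -> cancel g g' -> cancel g' g -> AutD y -> rotates g t y -> y z = z ->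
  @deriv_at R (Disk R) (Disk R) (@disk_chart R) (@disk_chart R) y z (circle t).
Proof.
move=> gA gK g'K yA yt yz; set c := @disk_chart R.
have cc : @is_chart R (Disk R) c := rs_charts disk_atlas.
have holo (h : Disk R -> Disk R) w : AutD h -> exists a, deriv_at c c h w a.
  by move=> hA; apply: deriv_at_holo (AutD_holo hA) disk_atlas disk_atlas _ _.
have [al ga] := holo g z gA; have [be g'b] := holo g' (g z) (AutD_can gA g'K).
have [la yl] := holo y z yA.
have ba : be * al = 1.
  have gg : g' \o g = id by apply/funext => w; exact: gK.
  have := deriv_at_comp cc cc ga g'b; rewrite gg => id_ba.
  exact: deriv_at_uniq id_ba (deriv_at_id cc I).
have gy : @deriv_at R (Disk R) (Disk R) c c (g \o y) z (al * la).
  by apply: deriv_at_comp yl _ => //; rewrite yz.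
have gy' : @deriv_at R (Disk R) (Disk R) c c (g \o y) z (circle t * al).
  case: gy => cz dz gyc _; split=> //; case: ga => _ _ _ g_der.
  have -> : cmap c \o (g \o y) \o cinv c = circle t *: (cmap c \o g \o cinv c).
    by apply/funext => v /=; rewrite yt.
  exact: is_deriveZ.
suff <- : la = circle t by [].
have := deriv_at_uniq gy gy'; rewrite [al * la]mulrC => /(congr1 ( *%R^~ be)).
by rewrite -!mulrA [al * be]mulrC ba !mulr1.
Qed.

End DiskDerivative.

(** * Generators and stabilizers *)

Lemma iter_iter_id (T : Type) (f : T -> T) n i :
  iter n f = id -> iter n (iter i f) = id.
Proof.
move=> fn; apply/funext => w; rewrite -iterM mulnC iterM fn.
by elim: i => //= i ->.
Qed.

Lemma iter_mod_id (T : Type) (f : T -> T) n i :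
  iter n f = id -> iter (i %% n) f = iter i f.
Proof.
move=> fn; apply/funext => w; rewrite [in RHS](divn_eq i n) addnC iterD iterM fn.
by congr (iter _ _ _); elim: (i %/ n)%N => //= k <-.
Qed.

Lemma iter_powers_group (T : Type) (f : T -> T) n :
  (0 < n)%N -> iter n f = id -> is_group [set u | exists k, u = iter k f].
Proof.
move=> n0 fn; split; first by exists 0%N.
  move=> _ _ [k ->] [l ->]; exists (k + l)%N.
  by apply/funext => w; rewrite /= iterD.
move=> _ [k ->]; exists (iter (n.-1 * k) f).
have kn : (n.-1 * k + k = k * n)%N by rewrite -mulSnr prednK // mulnC.
split; first by exists (n.-1 * k)%N.
  by apply/funext => w; rewrite /= -iterD kn iterM fn iter_fix.
by apply/funext => w; rewrite /= -iterD addnC kn iterM fn iter_fix.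
Qed.

(** F = f o piK is locally biholomorphic at z, with local inverse sg o f' for a
    local section sg of piK, and theta y is y read through F. *)
Lemma delta_induced (R : realType) (S Q : riemannSurface R)
    (Gamma K : set (Disk R -> Disk R)) (G : set (S -> S))
    (piK : Disk R -> Q) (f : Q -> S) (f' : S -> Q)
    (theta : (Disk R -> Disk R) -> (S -> S)) g g' (t : R)
    (y : Disk R -> Disk R) (z : Disk R) :
  subgroup K (@AutD R) -> discrete_in_AutD K ->
  (forall k, K k -> k z = z -> k = id) ->
  is_quotient K piK -> biholomorphic f -> cancel f f' -> cancel f' f ->
  induced_epimorphism Gamma K G piK f f' theta ->
  AutD g -> cancel g g' -> cancel g' g -> Gamma y -> AutD y -> rotates g t y ->
  y z = z -> delta (f (piK z)) (theta y) = circle t.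
Proof.
move=> Ksub Kdisc free quo [f_holo [f'0 [f'_holo f0K f'0K]]] fK f'K.
have <- : f'0 = f'.
  by apply/funext => P; rewrite -{2}(f'0K P) fK.
clear f' fK f'K; rename f'0 into f'; rename f0K into fK; rename f'0K into f'K.
move=> [_ _ _ ind] gA gK g'K Gy yA yt yz.
have [_ KA] := Ksub.
have [U [Uo Uz Ufree]] := wandering_nbhs Ksub Kdisc free.
have K_holo k : K k -> holo_map k by move=> /KA; exact: AutD_holo.
have [sg [sgE sg_der]] := quotient_local_section quo K_holo Uo Uz Ufree.
have [cQ caQ cQz] := rs_cover (piK z).
have [cS caS cSz] := rs_cover (f (piK z)).
have cD := @disk_atlas R.
have [a1 pi_a1] := deriv_at_quotient quo cD caQ I cQz.
have [a2 f_a2] := deriv_at_holo f_holo caQ caS cQz cSz.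
have f'z : f' (f (piK z)) = piK z by rewrite fK.
have f'Qz : cdom cQ (f' (f (piK z))) by rewrite f'z.
have [b1 f'_b1] := deriv_at_holo f'_holo caS caQ cSz f'Qz.
have [b2 sg_b2] : exists b, deriv_at cQ (@disk_chart R) sg (f' (f (piK z))) b.
  by rewrite f'z; exact: sg_der.
have F_der := deriv_at_comp (rs_charts cD) (rs_charts caQ) pi_a1 f_a2.
have L_der := deriv_at_comp (rs_charts caS) (rs_charts caQ) f'_b1 sg_b2.
have near_piU : \forall w \near f (piK z), exists2 v, U v & f (piK v) = w.
  have piU : nbhs (f' (f (piK z))) (piK @` U).
    apply: open_nbhs_nbhs; split; last by exists z; rewrite ?f'z.
    by apply: (quotient_open quo) => // k /K_holo[].
  have : \forall w \near f (piK z), (piK @` U) (f' w) by exact: (proj1 f'_holo _ _ piU).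
  by apply: filterS => w /= [v Uv vw]; exists v => //; rewrite vw f'K.
apply: (delta_semiconj cD caS F_der L_der _
  (deriv_at_rotates gA gK g'K yA yt yz) yz) => /=.
- by rewrite f'z sgE.
- by apply: filterS near_piU => w [v Uv <-] /=; rewrite fK sgE.
apply: filterS near_piU => w [v Uv <-] /=; rewrite fK sgE //.
have [yt' [_ yt'E ->]] := ind _ Gy.
by rewrite /= fK; congr f; exact: (congr1 (@^~ v) yt'E).
Qed.

Theorem theorem3p4 (R : realType)
  (S : riemannSurface R) (S_compact : compact [set: S])
  (g : nat) (S_genus : has_genus S g) (g_ge2 : (2 <= g)%N)
  (G : set (S -> S)) (G_aut : subgroup G (Aut S))
  (r : nat) (m : 'I_r -> nat) (G_sig : has_signature G 0 m)
  (Gamma : set (Disk R -> Disk R)) (Gamma_fuchsian : fuchsian Gamma)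
  (Gamma_sig : has_signature Gamma 0 m)
  (x : 'I_r -> (Disk R -> Disk R))
  (x_canonical : canonical_generators Gamma m x)
  (K : set (Disk R -> Disk R)) (K_normal : normal_subgroup K Gamma)
  (K_torsion_free : torsion_free K)
  (Q : riemannSurface R) (piK : Disk R -> Q) (Q_quotient : is_quotient K piK)
  (f : Q -> S) (f' : S -> Q) (f_iso : biholomorphic f)
  (fK : cancel f f') (f'K : cancel f' f)
  (theta : (Disk R -> Disk R) -> (S -> S))
  (theta_epi : induced_epimorphism Gamma K G piK f f' theta)
  (z : 'I_r -> Disk R) (z_fixed : forall j, x j (z j) = z j)
  (P : 'I_r -> S) (P_def : forall j, P j = f (piK (z j)))
  (j : 'I_r) (tau : S -> S) (tau_gen : generates tau (stab G (P j))) :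
  exists eta : nat,
    unique (fun e : nat =>
      [/\ (1 <= e < m j)%N, coprime e (m j) &
          delta (P j) tau = omega R (m j) ^+ e]) eta /\
    exists xi : nat,
      unique (fun k : nat =>
        [/\ (1 <= k < m j)%N, coprime k (m j) &
            (eta * k = 1 %[mod m j])%N]) xi /\
      theta (x j) = iter xi tau.
Proof.
have [Gamma_sub [e e0 discr] _ _ _] := Gamma_fuchsian.
have [Gamma_grp GammaA] := Gamma_sub.
have [_ [_ [_ [_ _ _ _ /(_ j)[m_ge2 _]]]]] := G_sig.
have [[Gamma_gen x_order _ _] _ x_rot] := x_canonical.
have [[K_grp K_Gamma] _] := K_normal.
have [theta_img thetaM K_ker theta_ind] := theta_epi.
have Gamma_id : Gamma id by case: Gamma_grp.
have GammaM u v : Gamma u -> Gamma v -> Gamma (u \o v).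
  by case: Gamma_grp => _ + _; apply.
have Gamma_x : Gamma (x j) by rewrite -Gamma_gen; apply: generated_sub; exists j.
have Gamma_xn n : Gamma (iter n (x j)) by exact: group_iter.
have theta_id : theta id = id.
  have : K id by case: K_grp.
  by rewrite K_ker => -[].
have theta_iter n y : Gamma y -> theta (iter n y) = iter n (theta y).
  move=> Gy; elim: n => [//|n IHn].
  rewrite -[iter n.+1 y]/(y \o iter n y) thetaM ?IHn //.
  exact: group_iter.
set s := theta (x j).
have s_order : iter (m j) s = id by rewrite /s -theta_iter // x_order.
have stab_x y : Gamma y -> y (z j) = z j -> exists i, y = iter i (x j).
  exact: stab_canonical_generator Gamma_sub x_canonical m_ge2 (z_fixed j).
have xn_z n : iter n (x j) (z j) = z j.
  by elim: n => //= n ->; exact: z_fixed.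
(* an element of K that fixes z_j is a power of x_j, so it has finite order *)
have K_free k : K k -> k (z j) = z j -> k = id.
  move=> Kk kz; have [i ki] := stab_x _ (K_Gamma _ Kk) kz.
  apply: (K_torsion_free _ (m j) Kk); first exact: ltnW.
  by rewrite ki iter_iter_id // x_order.
have delta_s n : delta (P j) (iter n s) = omega R (m j) ^+ n.
  have [g0 [g0' [gA gK g'K x_rotates]]] := minimal_rotation_coordinate (x_rot j).
  rewrite P_def /s -theta_iter // omegaE -circleMn.
  apply: (delta_induced _ _ K_free Q_quotient f_iso fK f'K theta_epi gA gK g'K).
  - by split=> // k /K_Gamma /GammaA.
  - by exists e => // a b k /K_Gamma; exact: discr.
  - exact: Gamma_xn.
  - exact/GammaA/Gamma_xn.
  - exact: rotates_iter.
  - exact: xn_z.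
have stab_P u : stab G (P j) u -> exists i, u = iter i s.
  move=> [Gu uP]; move: Gu; rewrite -theta_img => -[y Gy yu].
  have [yt [_ ytE yt_theta]] := theta_ind _ Gy.
  have : piK (y (z j)) = piK (z j).
    have := uP; rewrite -yu yt_theta P_def /= fK => /(can_inj fK) <-.
    exact: (congr1 (@^~ (z j)) ytE).
  (* y is corrected by an element k of K = ker theta into one that fixes z_j *)
  case: Q_quotient => _ orb _ _ /orb[k Kk kyz].
  have [i kyE] := stab_x _ (GammaM _ _ (K_Gamma _ Kk) Gy) kyz.
  exists i; rewrite /s -theta_iter // -kyE thetaM //; last exact: K_Gamma.
  by move: Kk; rewrite K_ker => -[_ ->].
have stab_s : stab G (P j) s.
  split; first by rewrite -theta_img; exists (x j).
  have [xt [_ xtE sE]] := theta_ind _ Gamma_x.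
  rewrite /s sE P_def /= fK; congr f.
  by have := congr1 (@^~ (z j)) xtE; rewrite /= z_fixed.
case: tau_gen => /stab_P[q tauE] tau_gen.
have tau_order : iter (m j) tau = id by rewrite tauE iter_iter_id.
have m_gt0 : (0 < m j)%N by exact: ltnW.
have [k sE] : exists k, s = iter k tau.
  have : generated [set tau] s by rewrite tau_gen.
  move=> /(_ [set u | exists k, u = iter k tau]); apply.
    exact: iter_powers_group m_gt0 tau_order.
  by move=> _ ->; exists 1%N.
have kq1 : (k * q = 1 %[mod m j])%N.
  apply/(@omegaX_eq R (m j)) => //; rewrite -!delta_s; congr delta.
  by apply/funext => w; rewrite iterM -tauE -sE.
have unit_mod (u v : nat) : (u * v = 1 %[mod m j])%N ->
    (1 <= u %% m j < m j)%N /\ coprime (u %% m j) (m j).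
  move=> uv; rewrite ltn_pmod // andbT coprime_modl.
  have u_co : coprime u (m j).
    have : coprime (u * v) (m j) by rewrite -coprime_modl uv coprime_modl coprime1n.
    by rewrite coprimeMl => /andP[].
  split=> //; rewrite lt0n; apply: contraTneq u_co => u0.
  by rewrite -coprime_modl u0 /coprime gcd0n gtn_eqF.
have [q_itv q_co] : (1 <= q %% m j < m j)%N /\ coprime (q %% m j) (m j).
  by apply: (unit_mod _ k); rewrite mulnC.
have [k_itv k_co] := unit_mod _ _ kq1.
have eqm_small u v : (1 <= u < m j)%N -> (1 <= v < m j)%N ->
    (u = v %[mod m j])%N -> u = v.
  by move=> /andP[_ um] /andP[_ vm]; rewrite !modn_small.
exists (q %% m j)%N; split.
  split.
    split=> //; rewrite tauE delta_s.
    by apply/(@omegaX_eq R (m j)) => //; rewrite modn_mod.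
  move=> e' [e'_itv _]; rewrite tauE delta_s => /(omegaX_eq _ _ _ m_gt0) e'q.
  by apply: eqm_small => //; rewrite modn_mod.
exists (k %% m j)%N; split; last by rewrite iter_mod_id.
split; first by split=> //; rewrite modnMm mulnC.
move=> k' [k'_itv _ qk']; apply: eqm_small => //.
(* k' = k * q * k' = k mod m_j *)
rewrite modnMml in qk'; rewrite modn_mod.
transitivity ((k * q * k') %% m j)%N; first by rewrite -mulnA -modnMmr qk' modnMmr muln1.
by rewrite -modnMml kq1 modnMml mul1n.
Qed.
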